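(* Let $\Phi$ be a reduced irreducible root system of rank $\ge 2$, let $R$ be a commutative ring with $1$, and let $A,B$ be two ideals of $R$. Assume: ( * ) in the cases $\Phi=\mathrm{C}_2,\mathrm{G}_2$ the ring $R$ does not have residue fields of two elements, and in the case $\Phi=\mathrm{C}_l$, $l\ge 2$, additionally any $c\in R$ is contained in the ideal $c^2R+2cR$. Then for all $a\in A$, $b\in B$ one has: (1) $y_{\alpha}(a,b)\equiv y_{\beta}(a,b)\pmod{E(\Phi,R,AB)}$ for any roots $\alpha,\beta\in\Phi$ of the same length; (2) $y_{\alpha}(a,b)\equiv y_{\beta}(a,b)^{p}\pmod{E(\Phi,R,AB)}$ if the root $\alpha\in\Phi$ is short and the root $\beta\in\Phi$ is long, where $p=2$ for $\Phi=\mathrm{B}_l,\mathrm{C}_l,\mathrm{F}_4$, and $p=3$ for $\Phi=\mathrm{G}_2$.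
   Context: $G(\Phi,R)$ is a Chevalley group of type $\Phi$ over $R$ with a fixed split maximal torus, and $x_{\alpha}(\xi)$, $\alpha\in\Phi$, $\xi\in R$, are the corresponding elementary root unipotents (parametrised in the usual way via a Chevalley basis). The absolute elementary subgroup is $E(\Phi,R)=\langle x_\alpha(\xi)\mid \alpha\in\Phi,\ \xi\in R\rangle$. For an ideal $I$ of $R$, $E(\Phi,I)=\langle x_\alpha(\xi)\mid\alpha\in\Phi,\ \xi\in I\rangle$, and the relative elementary subgroup $E(\Phi,R,I)$ is the normal closure of $E(\Phi,I)$ in $E(\Phi,R)$. $AB$ is the product ideal. Commutators are $[x,y]=xyx^{-1}y^{-1}$. The elementary commutators are $y_{\alpha}(a,b)=[x_{\alpha}(a),x_{-\alpha}(b)]$. For $g,h\in E(\Phi,R)$, $g\equiv h\pmod{E(\Phi,R,AB)}$ means that $g$ and $h$ have the same class modulo the normal subgroup $E(\Phi,R,AB)$ of $E(\Phi,R)$. $\mathrm{B}_2$ and $\mathrm{C}_2$ denote the same root system. *)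

(* Defs.v *)
From HB Require Import structures.
From mathcomp Require Import all_boot all_order all_algebra.
From mathcomp Require Import sesquilinear classical_sets.

Set Implicit Arguments.
Unset Strict Implicit.
Unset Printing Implicit Defensive.

Import Order.TTheory GRing.Theory Num.Theory.
Local Open Scope ring_scope.
Local Open Scope classical_set_scope.

Section RootSystems.
Context (F : realFieldType).

(* cartan dot b a = <b, a^\vee> *)
Definition cartan (V : vectType F) (dot : V -> V -> F) (b a : V) : F :=
  2 * dot b a / dot a a.

Record root_system (V : vectType F) (dot : {dot V for idfun}) := RootSystem {
  rs_roots : seq V;
  roots_span : (<<rs_roots>> = fullv)%VS;
  roots_neq0 : 0 \notin rs_roots;
  roots_reflection : forall a b : V, a \in rs_roots -> b \in rs_roots ->
    b - cartan dot b a *: a \in rs_roots;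
  roots_integral : forall a b : V, a \in rs_roots -> b \in rs_roots ->
    exists z : int, cartan dot b a = z%:~R
}.

Context (V : vectType F) (dot : {dot V for idfun}).
Implicit Types (Phi : root_system dot) (a b : V).

Definition reduced Phi : Prop :=
  forall a (c : F), a \in rs_roots Phi -> c *: a \in rs_roots Phi -> c = 1 \/ c = -1.

Definition irreducible Phi : Prop :=
  forall P : V -> Prop,
    (exists2 a, a \in rs_roots Phi & P a) -> (exists2 b, b \in rs_roots Phi & ~ P b) ->
  exists a b, [/\ a \in rs_roots Phi, b \in rs_roots Phi, P a, ~ P b & dot a b != 0].

(* The ambient space is spanned by the roots. *)
Definition rs_rank Phi : nat := \dim {: V}.

Definition long_root Phi b : Prop :=
  b \in rs_roots Phi /\ forall a, a \in rs_roots Phi -> dot a a <= dot b b.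

(* If all roots have the same length they are all long. *)
Definition short_root Phi a : Prop := a \in rs_roots Phi /\ ~ long_root Phi a.

Definition rowdot m (u v : 'rV[F]_m) : F := (u *m v^T) 0 0.

Definition stdB l : set 'rV[F]_l := [set v |
  (exists i (s : bool), v = (-1) ^+ s *: 'e_i) \/
  (exists i j (s t : bool), i != j /\ v = (-1) ^+ s *: 'e_i + (-1) ^+ t *: 'e_j)].

Definition stdC l : set 'rV[F]_l := [set v |
  (exists i (s : bool), v = (-1) ^+ s *: (2 *: 'e_i)) \/
  (exists i j (s t : bool), i != j /\ v = (-1) ^+ s *: 'e_i + (-1) ^+ t *: 'e_j)].

Definition stdF4 : set 'rV[F]_4 := [set v |
  stdB v \/ exists s : 'I_4 -> bool, v = \row_i ((-1) ^+ s i / 2)].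

Definition stdG2 : set 'rV[F]_3 := [set v |
  (exists i j, i != j /\ v = 'e_i - 'e_j) \/
  (exists i j k (s : bool), [/\ i != j, j != k, i != k &
     v = (-1) ^+ s *: (2 *: 'e_i - 'e_j - 'e_k)])].

(* Isomorphism of root systems; the ambient space of Psi may be larger than
   the span of Psi, as it is for stdG2. *)
Definition root_isom Phi m (Psi : set 'rV[F]_m) : Prop :=
  exists f : {linear V -> 'rV[F]_m},
    [/\ injective f, f @` [set a | a \in rs_roots Phi] = Psi &
        forall a b, a \in rs_roots Phi -> b \in rs_roots Phi ->
          cartan (@rowdot m) (f b) (f a) = cartan dot b a].

Definition typeB Phi l : Prop := root_isom Phi (@stdB l).
Definition typeC Phi l : Prop := root_isom Phi (@stdC l).
Definition typeF4 Phi : Prop := root_isom Phi stdF4.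
Definition typeG2 Phi : Prop := root_isom Phi stdG2.

(* The lower end of the a-string through b is b - p a. *)
Definition string_down Phi a b (p : nat) : Prop :=
  b - a *+ p \in rs_roots Phi /\
  forall k : nat, b - a *+ k \in rs_roots Phi -> (k <= p)%N.

Definition lie n (A B : 'M[int]_n) : 'M[int]_n := A * B - B * A.

(* The images e_a of the root vectors of a Chevalley basis under a faithful
   representation, written in a basis of an admissible lattice Z^n.  The weight
   lattice of the representation is arbitrary, so every isogeny type occurs.
   chevalley_coroot expresses [h_a, e_b] = <b, a^\vee> e_b for h_a = [e_a, e_{-a}],
   and chevalley_dvd says that the e_a^k / k! preserve Z^n.  As the simple
   Lie algebra of type Phi has no proper ideals, faithfulness amounts to
   e_a != 0.  The value of e outside Phi is a dummy. *)
Record chevalley_rep Phi (n : nat) := ChevalleyRep {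
  rootvec :> V -> 'M[int]_n;
  chevalley_out : forall a, a \notin rs_roots Phi -> rootvec a = 0;
  chevalley_faithful : forall a, a \in rs_roots Phi -> rootvec a != 0;
  chevalley_coroot : forall a b (z : int),
    a \in rs_roots Phi -> b \in rs_roots Phi -> cartan dot b a = z%:~R ->
    lie (lie (rootvec a) (rootvec (- a))) (rootvec b) = rootvec b *~ z;
  chevalley_add : forall a b (p : nat),
    a \in rs_roots Phi -> b \in rs_roots Phi -> a + b \in rs_roots Phi ->
    string_down Phi a b p ->
    lie (rootvec a) (rootvec b) = rootvec (a + b) *+ p.+1 \/
    lie (rootvec a) (rootvec b) = - (rootvec (a + b) *+ p.+1);
  chevalley_comm : forall a b,
    a \in rs_roots Phi -> b \in rs_roots Phi -> a + b != 0 -> a + b \notin rs_roots Phi ->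
    lie (rootvec a) (rootvec b) = 0;
  chevalley_dvd : forall a (k : nat) i j, (k`!%:Z %| (rootvec a ^+ k) i j)%Z
}.

(* X^k / k!, a truncated division which is exact for X = e_a. *)
Definition divpow n (X : 'M[int]_n) (k : nat) : 'M[int]_n :=
  \matrix_(i, j) ((X ^+ k) i j %/ k`!%:Z)%Z.

(* exp (xi X); the terms of degree >= n vanish for X = e_a (rootvec_nilp). *)
Definition expmx (R : comPzRingType) n (X : 'M[int]_n) (xi : R) : 'M[R]_n :=
  \sum_(k < n) xi ^+ k *: map_mx intr (divpow X k).

End RootSystems.

Section Nilpotency.

Lemma lie_exp n (H X : 'M[int]_n) : lie H X = X *+ 2 ->
  forall k, lie H (X ^+ k) = X ^+ k *+ (2 * k).
Proof.
move=> HX; elim=> [|k IHk]; first by rewrite expr0 /lie mulr1 mul1r subrr muln0.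
have Hm (A B : 'M[int]_n) : lie H (A * B) = lie H A * B + A * lie H B.
  by rewrite /lie mulrBl mulrBr !mulrA addrA subrK.
by rewrite exprS Hm HX IHk mulrnAl mulrnAr -mulrnDr mulnS.
Qed.

Lemma lie2_nilp n (H X : 'M[int]_n) : lie H X = X *+ 2 -> X ^+ n = 0.
Proof.
case: n H X => [|n] H X HX; first by apply/matrixP => -[].
pose q := char_poly X.
have key m : (m <= n.+1)%N -> exists c : nat -> int,
    [/\ \sum_(i < n.+2) c i *: X ^+ i = 0, forall i, (i < m)%N -> c i = 0
      & c n.+1 != 0].
  elim: m => [_|m IHm lmn]; last first.
    have [c [c0 cz cn]] := IHm (ltnW lmn).
    exists (fun i => c i * (i%:Z - m%:Z)); split; last 2 first.
    - move=> i; rewrite ltnS leq_eqVlt => /orP[/eqP->|/cz->]; rewrite ?mul0r //.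
      by rewrite subrr mulr0.
    - by rewrite mulf_neq0 // subr_eq0 eqz_nat gtn_eqF.
    have L : lie H (\sum_(i < n.+2) c i *: X ^+ i) =
             (\sum_(i < n.+2) (c i * i%:Z) *: X ^+ i) *+ 2.
      rewrite /lie mulr_sumr mulr_suml -sumrB -sumrMnl; apply: eq_bigr => i _.
      rewrite -scalerAr -scalerAl -scalerBr -/(lie _ _) lie_exp //.
      by rewrite mulnC mulrnA -scalerMnr -scalerA -[X in _ *: (X *: _)]natz scaler_nat.
    have : (\sum_(i < n.+2) (c i * i%:Z) *: X ^+ i) *+ 2 = 0.
      by rewrite -L c0 /lie mulr0 mul0r subrr.
    rewrite -scaler_nat => /eqP; rewrite scalemx_eq0 => /orP[//|/eqP S0].
    under eq_bigr do rewrite mulrBr scalerBl.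
    rewrite sumrB S0; under eq_bigr do rewrite mulrC -scalerA.
    by rewrite -scaler_sumr c0 scaler0 subrr.
  exists (fun i => q`_i); split=> //; last first.
    rewrite -[n.+1]/(n.+2.-1) -(size_char_poly X) -lead_coefE.
    by rewrite (eqP (char_poly_monic X)) oner_eq0.
  rewrite -[RHS](Cayley_Hamilton X) /horner_mx /horner_morph.
  rewrite (@horner_coef_wide _ n.+2); last first.
    by rewrite (leq_trans (size_poly _ _)) ?size_char_poly.
  by apply: eq_bigr => i _; rewrite coef_map /= [RHS]mul_scalar_mx.
have [c [c0 cz cn]] := key _ (leqnn n.+1).
move: c0; rewrite big_ord_recr big1 /=; last by move=> i _; rewrite cz ?scale0r.
by rewrite add0r => /eqP; rewrite scalemx_eq0 (negPf cn) => /eqP.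
Qed.

End Nilpotency.

Section Exponential.
Context (F : realFieldType) (V : vectType F) (dot : {dot V for idfun}).
Context (Phi : root_system dot) (n : nat) (e : chevalley_rep Phi n).

Lemma rootvec_nilp a : e a ^+ n = 0.
Proof.
have [aP|aP] := boolP (a \in rs_roots Phi); last first.
  rewrite (chevalley_out e aP); case: {+}n => [|m]; last by rewrite expr0n.
  by apply/matrixP => -[].
have a0 : dot a a != 0.
  by rewrite gt_eqF// neq0_dnorm_gt0//; apply: contraNneq (roots_neq0 Phi) => <-.
have c2 : cartan dot a a = 2 by rewrite /cartan mulfK.
have NaP : - a \in rs_roots Phi.
  by have := roots_reflection aP aP; rewrite c2 scaler_nat mulr2n opprD addrA subrr sub0r.
exact: lie2_nilp (chevalley_coroot e (z := 2) aP aP c2).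
Qed.

Lemma divpowK a k : divpow (e a) k *+ k`! = e a ^+ k.
Proof.
apply/matrixP => i j; rewrite mulmxnE mxE -[RHS](divzK (chevalley_dvd e a k i j)).
by rewrite -mulr_natr natz.
Qed.

Lemma mulrn_mx_inj m (M N : 'M[int]_n) : (0 < m)%N -> M *+ m = N *+ m -> M = N.
Proof.
move=> m_gt0 MN; apply/matrixP => i j; apply: (@mulIf _ m%:R).
  by rewrite pnatr_eq0 -lt0n.
by rewrite !mulr_natr -!mulmxnE MN.
Qed.

Lemma divpow0 a : divpow (e a) 0 = 1.
Proof. by rewrite -[RHS](expr0 (e a)) -divpowK. Qed.

Lemma divpow_ge a k : (n <= k)%N -> divpow (e a) k = 0.
Proof.
move=> nk; apply: (mulrn_mx_inj (fact_gt0 k)).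
by rewrite divpowK mul0rn -(subnK nk) exprD rootvec_nilp mulr0.
Qed.

Lemma divpowM a i j :
  divpow (e a) i * divpow (e a) j = divpow (e a) (i + j) *+ 'C(i + j, i).
Proof.
apply: (@mulrn_mx_inj (i`! * j`!)); first by rewrite muln_gt0 !fact_gt0.
have := bin_fact (leq_addr j i); rewrite addKn -mulrnA => ->.
rewrite divpowK exprD -!divpowK.
by rewrite mulrnAl mulrnAr mulnC mulrnA.
Qed.

Lemma expmx_wide (R : comPzRingType) a (xi : R) m : (n <= m)%N ->
  expmx (e a) xi = \sum_(k < m) xi ^+ k *: map_mx intr (divpow (e a) k).
Proof.
move=> nm; rewrite /expmx (big_ord_widen _ (fun k => xi ^+ k *: map_mx intr (divpow (e a) k)) nm).
rewrite [RHS](bigID (fun i : 'I_m => (i < n)%N)) /= [X in _ + X]big1 ?addr0 // => i.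
by rewrite -leqNgt => /(divpow_ge a) ->; rewrite map_mx0 scaler0.
Qed.

Lemma expmxD (R : comPzRingType) a (xi eta : R) :
  expmx (e a) xi * expmx (e a) eta = expmx (e a) (xi + eta).
Proof.
pose G i m : 'M[R]_n :=
  (xi ^+ i * eta ^+ (m - i) *+ 'C(m, i)) *: map_mx intr (divpow (e a) m).
transitivity (\sum_(0 <= i < n) \sum_(0 <= m < n | (i <= m)%N) G i m).
  rewrite /expmx mulr_suml big_mkord; apply: eq_bigr => i _.
  have -> : \sum_(0 <= m < n | (i <= m)%N) G i m = \sum_(0 + i <= m < n) G i m.
    by rewrite [RHS](@big_nat_widenl _ _ _ _ 0).
  rewrite mulr_sumr big_addn.
  rewrite -[RHS]addr0 -[X in _ + X](_ : \sum_(n - i <= j < n) G i (j + i)%N = 0).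
    rewrite -big_cat_nat ?leq_subr // big_mkord; apply: eq_bigr => j _.
    rewrite /G addnK -[LHS]/(_ *m _) -scalemxAl -scalemxAr scalerA -map_mxM.
    rewrite -[divpow _ _ *m _]/(_ * _) divpowM [(j + i)%N]addnC.
    by rewrite raddfMn /= -scalerMnl -scalerMnr.
  rewrite big_nat_cond big1 // => j /andP[/andP[+ _] _].
  by rewrite leq_subLR addnC => /(divpow_ge a); rewrite /G => ->; rewrite map_mx0 scaler0.
rewrite (exchange_big_dep_nat xpredT) //= big_mkord /expmx; apply: eq_bigr => m _.
have -> : \sum_(0 <= i < n | (i <= m)%N) G i m = \sum_(0 <= i < m.+1) G i m.
  by rewrite [RHS](@big_nat_widen _ _ _ _ _ n).
rewrite -scaler_suml addrC exprDn big_mkord; congr (_ *: _).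
by apply: eq_bigr => i _; rewrite mulrC.
Qed.

Lemma expmx0 (R : comPzRingType) a : expmx (e a) (0 : R) = 1.
Proof.
rewrite (@expmx_wide _ _ _ n.+1) // big_ord_recl big1 => [|i _].
  by rewrite addr0 expr0 scale1r divpow0 map_mx1.
by rewrite expr0n scale0r.
Qed.

End Exponential.

Section GeneralLinear.
Context (R : comPzRingType) (n : nat).

(* Invertible matrices, each given together with its (unique) inverse. *)
Record GL := MkGL {
  GL_pair : 'M[R]_n * 'M[R]_n;
  GL_pairP : (GL_pair.1 * GL_pair.2 == 1) && (GL_pair.2 * GL_pair.1 == 1)
}.
HB.instance Definition _ := [isSub for GL_pair].
HB.instance Definition _ := [Choice of GL by <:].

Definition GLval (g : GL) : 'M[R]_n := (GL_pair g).1.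

Definition GL_of (A B : 'M[R]_n) (AB : A * B = 1) (BA : B * A = 1) : GL :=
  @MkGL (A, B) (introT andP (conj (introT eqP AB) (introT eqP BA))).

Definition GL1 : GL := GL_of (mulr1 1) (mulr1 1).

Lemma GL_valV (g : GL) : GLval g * (GL_pair g).2 = 1.
Proof. by have /andP[/eqP] := GL_pairP g. Qed.

Lemma GL_Vval (g : GL) : (GL_pair g).2 * GLval g = 1.
Proof. by have /andP[_ /eqP] := GL_pairP g. Qed.

Definition GLinv (g : GL) : GL := GL_of (GL_Vval g) (GL_valV g).

Fact GLmul_subproof (g h : GL) :
  GLval g * GLval h * ((GL_pair h).2 * (GL_pair g).2) = 1.
Proof. by rewrite mulrA -(mulrA (GLval g)) GL_valV mulr1 GL_valV. Qed.

Fact GLmulV_subproof (g h : GL) :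
  (GL_pair h).2 * (GL_pair g).2 * (GLval g * GLval h) = 1.
Proof. by rewrite mulrA -(mulrA (GL_pair h).2) GL_Vval mulr1 GL_Vval. Qed.

Definition GLmul (g h : GL) : GL := GL_of (GLmul_subproof g h) (GLmulV_subproof g h).

Lemma GLval_inj : injective GLval.
Proof.
move=> g h gh; apply: val_inj; rewrite /= [LHS]surjective_pairing [RHS]surjective_pairing.
congr (_, _) => //; rewrite -[LHS]mulr1 -(GL_valV h) -gh mulrA GL_Vval mul1r //.
Qed.

Fact GLmulA : associative GLmul.
Proof. by move=> g h k; apply: GLval_inj; rewrite /GLval /= mulrA. Qed.
Fact GLmul1g : left_id GL1 GLmul.
Proof. by move=> g; apply: GLval_inj; rewrite /GLval /= mul1r. Qed.
Fact GLmulg1 : right_id GL1 GLmul.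
Proof. by move=> g; apply: GLval_inj; rewrite /GLval /= mulr1. Qed.
Fact GLmulVg : left_inverse GL1 GLinv GLmul.
Proof. by move=> g; apply: GLval_inj; apply: GL_Vval. Qed.
Fact GLmulgV : right_inverse GL1 GLinv GLmul.
Proof. by move=> g; apply: GLval_inj; apply: GL_valV. Qed.

HB.instance Definition _ :=
  isGroup.Build GL GLmulA GLmul1g GLmulg1 GLmulVg GLmulgV.

Lemma GLvalM (g h : GL) : GLval (g * h)%g = GLval g * GLval h.
Proof. by []. Qed.

Lemma GLval1 : GLval 1%g = 1.
Proof. by []. Qed.

End GeneralLinear.

Section Groups.
Context (G : groupType).
Local Open Scope group_scope.

Definition is_subgroup (H : set G) : Prop :=
  [/\ H 1, forall g h, H g -> H h -> H (g * h) & forall g, H g -> H g^-1].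

Definition gen_subgroup (S : set G) : set G := smallest is_subgroup S.

Definition normal_closure (E S : set G) : set G :=
  smallest (fun N => is_subgroup N /\
    forall g h, E g -> N h -> N (g * h * g^-1)) S.

(* The opposite convention of [~ g, h]. *)
Definition commutator (g h : G) : G := g * h * g^-1 * h^-1.

Definition eqmod (N : set G) (g h : G) : Prop := N (g^-1 * h).

End Groups.

Section Ideals.
Context (R : comPzRingType).

Definition is_ideal (I : set R) : Prop :=
  [/\ I 0, forall x y, I x -> I y -> I (x + y) & forall r x, I x -> I (r * x)].

Definition product_ideal (A B : set R) : set R :=
  smallest is_ideal [set x | exists a b, [/\ A a, B b & x = a * b]].

Definition maximal_ideal (M : set R) : Prop :=
  [/\ is_ideal M, M <> setT &
      forall J, is_ideal J -> M `<=` J -> J = M \/ J = setT].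

(* R / M consists of exactly two cosets. *)
Definition residue_field_card2 (M : set R) : Prop :=
  exists x y, ~ M (x - y) /\ forall z, M (z - x) \/ M (z - y).

Definition no_residue_field_card2 : Prop :=
  forall M, maximal_ideal M -> ~ residue_field_card2 M.

End Ideals.

Section ElementaryGroup.
Context (F : realFieldType) (V : vectType F) (dot : {dot V for idfun}).
Context (Phi : root_system dot) (n : nat) (e : chevalley_rep Phi n).
Context (R : comPzRingType).

Fact xroot_subproof a (xi : R) : expmx (e a) xi * expmx (e a) (- xi) = 1.
Proof. by rewrite expmxD subrr expmx0. Qed.

Fact xrootV_subproof a (xi : R) : expmx (e a) (- xi) * expmx (e a) xi = 1.
Proof. by rewrite expmxD addNr expmx0. Qed.

Definition xroot (a : V) (xi : R) : GL R n :=
  GL_of (xroot_subproof a xi) (xrootV_subproof a xi).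

(* E(Phi, I), inside GL_n(R), which contains the Chevalley group G(Phi, R)
   attached to the representation. *)
Definition elementary (I : set R) : set (GL R n) :=
  gen_subgroup [set g | exists a xi, [/\ a \in rs_roots Phi, I xi & g = xroot a xi]].

Definition relative_elementary (I : set R) : set (GL R n) :=
  normal_closure (elementary setT) (elementary I).

Definition ycomm (a : V) (x y : R) : GL R n :=
  commutator (xroot a x) (xroot (- a) y).

End ElementaryGroup.

(* Main.v *)
(* Write N = E(Phi, R, AB).  By the Chevalley commutator formula x_c(A) and x_d(B)
   commute modulo N as soon as c + d != 0.  Hence y_c(a, b) commutes modulo N with
   x_d(t) for d != c, -c.  As x_c(t) and x_{-c}(t) are conjugate to such elements by a
   Weyl group element w_g with g != c, -c, the class of y_c(a, b) is central.
   Conjugation by Weyl group elements now gives the first claim, since the Weyl group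
   permutes the roots of a given length transitively.  For the second claim take a long
   root d and a short root g with (d, g) < 0, and put z = d + g, a short root.
   Conjugating [x_d(a), x_g(1)] = ... x_z(c a) ... by x_{-z}(b), once on either side of
   this equation, yields y_z(c a, b) = y_d(a, c' b) modulo N; evaluating
   h_z = c [[e_d, e_g], e_{-z}] on e_d and e_g shows c' = c q with c = 1 or -1 and
   q = (d, d) / (g, g).
   The commutator formula and the action of w_g are proved over a field of
   characteristic 0, where exp(t X) is the only solution of P' = X P, P(0) = 1 among
   polynomials with matrix coefficients, and pass to R through Z[s, t]. *)
Require Import Defs.
From HB Require Import structures.
From mathcomp Require Import all_boot all_order all_algebra.
From mathcomp Require Import sesquilinear classical_sets boolp.
From mathcomp Require Import ring lra zify.

Set Implicit Arguments.
Unset Strict Implicit.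
Unset Printing Implicit Defensive.
Import Order.TTheory GRing.Theory Num.Theory.
Local Open Scope ring_scope.

(** * Exponentials of nilpotent elements *)

(** Two obstacles shape the argument: k! cannot be inverted in R, and the signs of the structure
    constants are unknown. Factorisations of exponentials are verified by differentiating in an
    auxiliary variable, so that a product rule takes the place of the Baker-Campbell-Hausdorff
    series; a letter at 2 a_0 + j b is quadratic in a_0 and carries the square of that variable.
    Signs remain existential almost everywhere, because in the computations modulo N the letters of
    the commutator formula other than the one at c + d drop out. Three facts about signs have to be
    settled. The vectors e_d and e_{-d} acquire the same sign under w_g, so y_d(a, b) goes to y(a,
    b) or y(-a, -b), and these agree once the class is central. In G_2 the coefficient at 2 a + 3 b
    is an integer because twice its value is a sum of 1 or -1 and 3 or -3. Finally c' = c q, and the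
    sign c then occurs in both arguments of y_d and cancels, leaving only the factor q, which
    becomes the exponent. *)

Lemma zmod_cancel (V : zmodType) (a0 a1 a2 a3 w x y : V) :
  a0 + a1 + a2 + a3 = a0 + ((a1 - w) + (a2 + y + ((a3 + x) + (w - (x + y))))).
Proof.
rewrite opprD -!addrA; congr (_ + (_ + _)); symmetry.
rewrite [x + _]addrCA (addrA x) subrr add0r [y + _]addrCA [y + _]addrCA subrr addr0.
by rewrite addrCA [- w + _]addrCA addNr addr0.
Qed.

Section NilpotentExponential.
Context (K : fieldType) (A : algType K).
Hypothesis natK : forall k : nat, k.+1%:R != 0 :> K.
Implicit Types (X Y v : A) (P Q D : {poly A}).

Lemma mulrn_algI k : injective (fun X => X *+ k.+1).
Proof.
move=> X Y /= XY; apply: (scalerI (natK k)).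
by rewrite !scaler_nat.
Qed.

(** Comparing coefficients of degree k gives (k + 1) P_(k+1) = Y P_k, so the constant term
    determines the rest once k + 1 is invertible. *)
Lemma poly_ode_uniq Y P Q : P^`() = Y%:P * P -> Q^`() = Y%:P * Q ->
  P`_0 = Q`_0 -> P = Q.
Proof.
move=> dP dQ PQ0; apply/polyP; elim=> [//|k IHk]; apply: (@mulrn_algI k).
by rewrite /= -!coef_deriv dP dQ !coefCM IHk.
Qed.

(** This is exp(T^d X) in the indeterminate T, written ['X], truncated at X^N; its value at T = 1 is
    [nexp N X]. *)
Definition gexp N d X : {poly A} :=
  \sum_(k < N) ((k`!%:R^-1 : K) *: X ^+ k) *: 'X^(d * k).

Definition nexp N X : A := \sum_(k < N) (k`!%:R^-1 : K) *: X ^+ k.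

Lemma natK_fact k : k`!%:R != 0 :> K.
Proof. by have := fact_gt0 k; case: k`! => // m _; apply: natK. Qed.

Lemma gexp_deriv N d X : X ^+ N = 0 ->
  (gexp N d.+1 X)^`() = (X *+ d.+1)%:P * 'X^d * gexp N d.+1 X.
Proof.
have swap (c : A) (m : nat) : (X *+ d.+1)%:P * 'X^d * (c *: 'X^m) =
    (X *+ d.+1 * c)%:P * 'X^(d + m).
  by rewrite -mul_polyC -mulrA (mulrA 'X^d) -commr_polyXn polyCM exprD !mulrA.
case: N => [|N] XN; first by rewrite /gexp !big_ord0 mulr0 deriv0.
rewrite {1}/gexp big_ord_recl muln0 derivD derivZ derivC scaler0 add0r.
rewrite /gexp big_ord_recr mulrDr swap -scalerAr mulrnAl -exprS XN mul0rn scaler0.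
rewrite mul0r addr0 mulr_sumr raddf_sum; apply: eq_bigr => i _ /=.
rewrite swap derivZ derivXn -mul_polyC.
have -> : (d.+1 * bump 0 i).-1 = (d + d.+1 * i)%N by rewrite /bump /=; lia.
rewrite mulrnAr -mulrnAl -polyCMn; congr (_ %:P * _).
rewrite /bump /= add1n factS natrM invfM -!scalerAr !mulrnAl -exprS.
rewrite mulnC mulrnA -!scalerMnr; congr (_ *+ _).
rewrite -scaler_nat scalerA; congr (_ *: _).
by have := natK i; have := natK_fact i => n1 n2; field; rewrite n1 nat1r.
Qed.

Lemma gexp0 N d X : X ^+ N = 0 -> (gexp N d.+1 X)`_0 = 1.
Proof.
case: N => [|N] XN; first by rewrite expr0 in XN; rewrite /gexp big_ord0 coef0 XN.
rewrite /gexp big_ord_recl coefD coef_sum big1 ?addr0 => [|i _].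
  by rewrite muln0 coefZ coef1 mulr1 fact0 invr1 scale1r.
by rewrite coefZ coefXn mulr0.
Qed.

Lemma horner1M P Q : (P * Q).[1] = P.[1] * Q.[1].
Proof. by rewrite hornerM_comm // /comm_poly mul1r mulr1. Qed.

Lemma gexp_horner1 N d X : (gexp N d X).[1] = nexp N X.
Proof.
rewrite /gexp /nexp horner_sum; apply: eq_bigr => i _.
by rewrite hornerZ hornerXn expr1n mulr1.
Qed.

(** Both sides solve P' = X P and have constant term D(0). The condition on D says that D = exp(T ad
    X) D(0). *)
Lemma gexp_conj N X D : X ^+ N = 0 -> D^`() = X%:P * D - D * X%:P ->
  gexp N 1 X * (D`_0)%:P = D * gexp N 1 X.
Proof.
move=> XN dD; have dE := gexp_deriv 0 XN; rewrite expr0 mulr1 in dE.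
apply: (poly_ode_uniq (Y := X)).
- by rewrite derivM derivC mulr0 addr0 dE mulrA.
- by rewrite derivM dE dD mulrBl -!mulrA addrNK.
- by rewrite coefMC coef0M gexp0 // mul1r mulr1.
Qed.

(** The v_i are the divided powers of ad X applied to v0, so D = v0 + v1 T + v2 T^2 + v3 T^3
    satisfies D' = [X, D]. Four terms suffice because a root string has at most four members. *)
Lemma nexp_ad N X v0 v1 v2 v3 : X ^+ N = 0 ->
  X * v0 - v0 * X = v1 -> X * v1 - v1 * X = v2 *+ 2 ->
  X * v2 - v2 * X = v3 *+ 3 -> X * v3 - v3 * X = 0 ->
  nexp N X * v0 = (v0 + v1 + v2 + v3) * nexp N X.
Proof.
move=> XN e0 e1 e2 e3.
have := @gexp_conj N X (Poly [:: v0; v1; v2; v3]) XN.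
rewrite coef_Poly [nth 0 _ 0]/= => h.
rewrite -(gexp_horner1 _ 1) -[v0 in LHS](hornerC v0 1) -horner1M h.
  rewrite horner1M horner_Poly /= mul0r add0r !mulr1; congr (_ * _).
  by rewrite [LHS]addrC (addrC (v3 + v2)) (addrC v3) !addrA.
apply/polyP => i; rewrite coef_deriv coefB coefCM coefMC !coef_Poly.
case: i => [|[|[|[|i]]]] /=; rewrite ?nth_nil ?mulr0 ?mul0r ?subrr ?mul0rn ?e3 //.
Qed.

Lemma gexp_comm N d X v : X * v = v * X -> gexp N d X * v%:P = v%:P * gexp N d X.
Proof.
move=> Xv; rewrite /gexp; symmetry; apply: GRing.commr_sum => i _.
rewrite -mul_polyC; apply: commrM; last exact: commr_polyXn.
rewrite /GRing.comm -!polyCM; congr _%:P.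
by rewrite -scalerAl -scalerAr; congr (_ *: _); apply/commrX/esym.
Qed.

Lemma gexp_heis N X v z : X ^+ N = 0 -> X * v - v * X = z -> X * z = z * X ->
  gexp N 1 X * v%:P = (v%:P + z%:P * 'X) * gexp N 1 X.
Proof.
move=> XN Xv Xz; rewrite -gexp_conj //.
  by rewrite coefD coefC coefMX addr0.
rewrite derivD derivC add0r derivM derivC mul0r add0r derivX mulr1.
have zX : X%:P * (z%:P * 'X) = z%:P * 'X * X%:P.
  by rewrite mulrA -polyCM Xz polyCM -mulrA commr_polyX mulrA.
by rewrite mulrDr mulrDl opprD addrACA zX subrr addr0 -!polyCM -polyCB Xv.
Qed.

(** This computes the logarithmic derivative of a product of exponentials, adding one factor on the
    left at a time. *)
Lemma ode_mul (E H a M M' : {poly A}) :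
  E^`() = a * E -> H^`() = M * H -> E * M = M' * E -> (E * H)^`() = (a + M') * (E * H).
Proof. by move=> dE dH EM; rewrite derivM dE dH mulrDl !mulrA EM. Qed.

(** Both sides are values at T = 1 of solutions of P' = Y P starting at g. On the right A_j is
    scaled by T and W_j by T^2; moving a factor past the later A_j produces brackets linear in T,
    and these are cancelled by the derivatives of the T^2 factors. *)
Lemma nexp_heisenberg N g Y A0 A1 A2 A3 W1 W3 Z03 Z12 :
  A0 ^+ N = 0 -> A1 ^+ N = 0 -> A2 ^+ N = 0 -> A3 ^+ N = 0 ->
  W1 ^+ N = 0 -> W3 ^+ N = 0 ->
  A0 * A1 - A1 * A0 = - (W1 *+ 2) -> A0 * A2 = A2 * A0 -> A0 * A3 - A3 * A0 = Z03 ->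
  A1 * A2 - A2 * A1 = Z12 -> A1 * A3 = A3 * A1 -> A2 * A3 = A3 * A2 ->
  Z03 + Z12 = - (W3 *+ 2) -> W1 * W3 = W3 * W1 ->
  (forall B, B \in [:: A0; A1; A2; A3] ->
     [/\ B * W1 = W1 * B, B * W3 = W3 * B, B * Z03 = Z03 * B & B * Z12 = Z12 * B]) ->
  Y = A0 + A1 + A2 + A3 -> g * A0 = Y * g ->
  g * nexp N A0 =
  nexp N A0 * nexp N A1 * nexp N A2 * nexp N A3 * nexp N W1 * nexp N W3 * g.
Proof.
move=> n0 n1 n2 n3 m1 m3 e01 e02 e03 e12 e13 e23 eZ eW cen eY eg.
have [c01 c03 c0z c0z'] := cen A0 (mem_head _ _).
have [] := cen A1; rewrite ?inE ?eqxx ?orbT // => c11 c13 c1z c1z'.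
have [] := cen A2; rewrite ?inE ?eqxx ?orbT // => c21 c23 c2z c2z'.
have [] := cen A3; rewrite ?inE ?eqxx ?orbT // => c31 c33 c3z c3z'.
have dE X : X ^+ N = 0 -> (gexp N 1 X)^`() = X%:P * gexp N 1 X.
  by move=> XN; rewrite gexp_deriv // expr0 mulr1.
have comX (X v : A) d : X * v = v * X ->
    gexp N d X * (v%:P * 'X) = v%:P * 'X * gexp N d X.
  by move=> Xv; rewrite mulrA gexp_comm // -!mulrA commr_polyX.
pose H5 := gexp N 2 W3 * g%:P.
have d5 : H5^`() = (W3 *+ 2)%:P * 'X * H5.
  by rewrite derivM derivC mulr0 addr0 gexp_deriv // expr1 mulrA.
pose H4 := gexp N 2 W1 * H5.
have d4 : H4^`() = ((W1 *+ 2)%:P * 'X + (W3 *+ 2)%:P * 'X) * H4.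
  apply: ode_mul d5 _; first by rewrite gexp_deriv // expr1.
  by apply: comX; rewrite mulrnAr mulrnAl eW.
pose V : A := W1 *+ 2 + W3 *+ 2.
rewrite -mulrDl -polyCD -/V in d4.
have cV (X : A) : X * W1 = W1 * X -> X * W3 = W3 * X -> X * V = V * X.
  by move=> X1 X3; rewrite /V mulrDr mulrDl !mulrnAr !mulrnAl X1 X3.
pose H3 := gexp N 1 A3 * H4.
have d3 : H3^`() = (A3%:P + V%:P * 'X) * H3.
  by apply: ode_mul d4 _; rewrite ?dE // comX // cV.
pose H2 := gexp N 1 A2 * H3.
have d2 : H2^`() = (A2%:P + (A3%:P + V%:P * 'X)) * H2.
  by apply: ode_mul d3 _; rewrite ?dE // mulrDr mulrDl comX ?cV // gexp_comm.
pose H1 := gexp N 1 A1 * H2.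
have d1 : H1^`() = (A1%:P + (A2%:P + Z12%:P * 'X + (A3%:P + V%:P * 'X))) * H1.
  apply: ode_mul d2 _; rewrite ?dE // mulrDr [RHS]mulrDl.
  rewrite (gexp_heis _ e12) //; congr (_ + _).
  by rewrite mulrDr mulrDl comX ?cV // gexp_comm.
pose H0 := gexp N 1 A0 * H1.
have d0 : H0^`() = Y%:P * H0.
  (* The terms linear in T cancel, since V = 2 W1 + 2 W3 = 2 W1 - Z03 - Z12. *)
  have -> : Y%:P = A0%:P + ((A1%:P - (W1 *+ 2)%:P * 'X) +
     (A2%:P + Z12%:P * 'X + ((A3%:P + Z03%:P * 'X) + V%:P * 'X))) :> {poly A}.
    have -> : V = W1 *+ 2 - (Z03 + Z12) by rewrite eZ opprK.
    rewrite eY !polyCD polyCN !polyCD !mulrDl mulNr mulrDl.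
    exact: zmod_cancel.
  apply: ode_mul d1 _; rewrite ?dE // mulrDr [RHS]mulrDl; congr (_ + _).
    rewrite (gexp_heis _ e01) ?polyCN ?mulNr //.
    by rewrite mulrN mulrnAr mulrnAl c01.
  rewrite mulrDr [RHS]mulrDl; congr (_ + _).
    by rewrite mulrDr mulrDl comX // gexp_comm.
  rewrite mulrDr [RHS]mulrDl; congr (_ + _).
    by rewrite (gexp_heis _ e03).
  by rewrite comX // cV.
have : (g%:P * gexp N 1 A0)^`() = Y%:P * (g%:P * gexp N 1 A0).
  by rewrite derivM derivC mul0r add0r dE // !mulrA -!polyCM eg.
move=> /poly_ode_uniq /(_ d0) e.
rewrite -(gexp_horner1 N 1) -[g in LHS](hornerC g 1) -horner1M e.
  by rewrite /H0 /H1 /H2 /H3 /H4 /H5 !horner1M !gexp_horner1 hornerC !mulrA.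
by rewrite !coef0M !coefC !eqxx !gexp0 // !mul1r mulr1.
Qed.

End NilpotentExponential.

Local Notation br X Y := (X * Y - Y * X).

Lemma br_jacobi (T : pzRingType) (X Y v : T) : br X (br Y v) = br (br X Y) v + br Y (br X v).
Proof.
rewrite !mulrBl !mulrBr !mulrA.
move: (X * Y * v) (X * v * Y) (Y * v * X) (v * Y * X) (Y * X * v) (v * X * Y) => p q r t u w.
rewrite !opprB [RHS]addrACA (addrA (p - u)) subrK (addrA (t - w)) subrK.
by rewrite [LHS]addrACA [RHS]addrACA (addrC (- q)).
Qed.

(** * Exponentials acting on SL_2-modules of dimension at most four *)

Section NilpotentExponential.
Context (K : fieldType) (A : algType K).
Hypothesis natK : forall k : nat, k.+1%:R != 0 :> K.
Implicit Types (X Y v : A).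
Implicit Type u : nat -> A.

(** B is the matrix of conjugation by g on the family u_0, ..., u_q, written as an intertwining
    relation so that no inverse of g appears. *)
Definition conj_acts u q (g : A) (B : nat -> nat -> int) :=
  forall i, (i <= q)%N -> g * u i = (\sum_(k < q.+1) u k *~ B k i) * g.

Lemma conj_acts_mul u q g h B C : conj_acts u q g B -> conj_acts u q h C ->
  conj_acts u q (g * h) (fun k i => \sum_(j < q.+1) B k j * C j i).
Proof.
move=> gB hC i iq; rewrite -mulrA hC // !mulrA; congr (_ * _).
transitivity (\sum_(j < q.+1) \sum_(k < q.+1) u k *~ (B k j * C j i) * g).
  rewrite mulr_sumr; apply: eq_bigr => j _.
  rewrite mulrzAr gB; last by rewrite -ltnS ltn_ord.
  rewrite mulr_suml mulrz_suml; apply: eq_bigr => k _.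
  by rewrite -mulrzAl mulrzA.
rewrite exchange_big mulr_suml; apply: eq_bigr => k _ /=.
by rewrite mulrz_sumr mulr_suml.
Qed.

(** The divided powers of ad X send u_i to binomial multiples of u_(i+j), so exp(X) acts through
    Pascal's matrix. The auxiliary w j is the j-th divided power applied to u_i. *)
Lemma nexp_acts N X u q : (q <= 3)%N -> X ^+ N = 0 ->
  (forall i, (i < q)%N -> X * u i - u i * X = u i.+1 *+ i.+1) ->
  X * u q - u q * X = 0 ->
  conj_acts u q (nexp N X) (fun k i => 'C(k, i)%:Z).
Proof.
move=> q3 XN Xu Xq i iq.
pose w j := if (i + j <= q)%N then u (i + j)%N *+ 'C(i + j, i) else 0.
have w0 : w 0%N = u i by rewrite /w addn0 iq binn.
have wS j : X * w j - w j * X = w j.+1 *+ j.+1.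
  rewrite /w; case: (ltngtP (i + j) q) => ijq.
  - rewrite addnS ijq mulrnAl mulrnAr -mulrnBl Xu // -!mulrnA; congr (_ *+ _).
    by have := mul_bin_down (i + j).+1 i; rewrite /= => ->; rewrite mulnC; congr (_ * _)%N; lia.
  - by rewrite addnS ltnNge ltnW //= mulr0 mul0r subrr mul0rn.
  - rewrite addnS ijq ltnn mulrnAl mulrnAr -mulrnBl Xq !mul0rn //.
rewrite (nexp_ad natK (v1 := w 1%N) (v2 := w 2) (v3 := w 3)) //; last first.
- rewrite wS /w (_ : (i + 4 <= q)%N = false) ?mul0rn //; lia.
- by rewrite -w0 wS.
congr (_ * _); rewrite -w0 /w.
case: q q3 iq {Xu Xq w w0 wS} => [|[|[|[|//]]]] _; case: i => [|[|[|[|//]]]] //= _;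
  by rewrite !big_ord_recl big_ord0 /= ?bin0 ?bin1 ?mulr0z ?mulr1z ?addr0 ?add0r ?addrA.
Qed.

(** This is the q-th symmetric power of the SL_2 identity expressing the Weyl element as a product
    of three unipotents; for q at most 3 it is a finite check. *)
Lemma weyl_coef q k i : (q <= 3)%N -> (k <= q)%N -> (i <= q)%N ->
  \sum_(j < q.+1) (\sum_(l < q.+1) 'C(k, l)%:Z *
     ((-1) ^+ (q - l + (q - j)) * 'C(q - l, q - j)%:Z)) * 'C(j, i)%:Z =
  if k == (q - i)%N then (-1) ^+ i else 0.
Proof.
case: q => [|[|[|[|//]]]] _; case: k => [|[|[|[|//]]]] //= _; case: i => [|[|[|[|//]]]] //= _;
  by rewrite !big_ord_recl !big_ord0.
Qed.

(* [u] is a basis of the Weyl module of highest weight [q], and the product of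
   exponentials represents the non-trivial element of the Weyl group of SL_2. *)
Lemma nexp_weyl N E F u q : (q <= 3)%N -> E ^+ N = 0 -> F ^+ N = 0 ->
  (forall i, (i < q)%N -> E * u i - u i * E = u i.+1 *+ i.+1) ->
  E * u q - u q * E = 0 ->
  (forall i, (i < q)%N -> F * u i.+1 - u i.+1 * F = u i *+ (q - i)) ->
  F * u 0%N - u 0%N * F = 0 ->
  let g := nexp N E * nexp N (- F) * nexp N E in
  forall i, (i <= q)%N -> g * u i = u (q - i)%N *~ (-1) ^+ i * g.
Proof.
move=> q3 EN FN Eu Eq Fu F0 g i iq.
have aE := nexp_acts q3 EN Eu Eq.
have aF : conj_acts u q (nexp N (- F))
    (fun k i => (-1) ^+ (q - k + (q - i)) * 'C(q - k, q - i)%:Z).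
  pose u' j := u (q - j)%N *~ (-1) ^+ j.
  have a' : conj_acts u' q (nexp N (- F)) (fun k i => 'C(k, i)%:Z).
    apply: nexp_acts => // [|j jq|]; first by rewrite exprNn FN mulr0.
    - have Fj : F * u (q - j)%N - u (q - j)%N * F = u (q - j.+1)%N *+ j.+1.
        by rewrite -(@subnSK j q) // Fu ?subSn ?subKn //; lia.
      rewrite /u' mulrzAl mulrzAr -mulrzBl mulNr mulrN -opprD Fj.
      by rewrite exprS mulN1r mulrNz mulNrz mulNrn !pmulrn mulrzAC.
    - by rewrite /u' subnn mulrzAl mulrzAr -mulrzBl mulNr mulrN -opprD F0 oppr0 mul0rz.
  move=> j jq.
  have -> : u j = u' (q - j)%N *~ (-1) ^+ (q - j).
    by rewrite /u' subKn // -mulrzA -exprD addnn -mul2n exprM sqrrN expr1n.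
  rewrite mulrzAr a' ?leq_subr // -mulrzAl mulrz_suml (reindex_inj rev_ord_inj) /=.
  congr (_ * _); apply: eq_bigr => k _.
  have kq : (k <= q)%N by rewrite -ltnS.
  rewrite /u' subSS subKn // -2!mulrzA exprD.
  by congr (_ *~ _); rewrite -!mulrA; congr (_ * _); rewrite mulrC.
rewrite (conj_acts_mul (conj_acts_mul aE aF) aE) //; congr (_ * _); cbv beta.
transitivity (\sum_(k < q.+1) u k *~ (if k == (q - i)%N :> nat then (-1) ^+ i else 0)).
  apply: eq_bigr => k _; rewrite weyl_coef //.
  by rewrite -ltnS.
have iq' : (q - i < q.+1)%N by rewrite ltnS leq_subr.
rewrite (bigD1 (Ordinal iq')) //= eqxx big1 ?addr0 // => k ki.
by rewrite ifN ?mulr0z.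
Qed.

Lemma brMz X v k : br X (v *~ k) = br X v *~ k.
Proof. by rewrite mulrzAr mulrzAl mulrzBl. Qed.

(** Only the action of E is known, and only up to signs. Rescaling the y_i by signs makes it
    standard, and the action of F then follows from the weights by the Jacobi identity, so the signs
    for F need not be known in advance. *)
Lemma weyl_conj N E F (y : nat -> A) q : (q <= 3)%N -> E ^+ N = 0 -> F ^+ N = 0 ->
  (forall i, (i < q)%N -> exists2 s : int, s = 1 \/ s = -1 &
     br E (y i) = y i.+1 *~ (s * i.+1%:Z)) ->
  br E (y q) = 0 -> br F (y 0%N) = 0 ->
  (forall i, (i <= q)%N -> br (br E F) (y i) = y i *~ (2 * i%:Z - q%:Z)) ->
  let g := nexp N E * nexp N (- F) * nexp N E in
  forall i, (i <= q)%N -> exists2 s : int, s = 1 \/ s = -1 &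
    g * y i = y (q - i)%N *~ s * g.
Proof.
move=> q3 EN FN Ey Eq F0 Hy g.
(* The sign sg i is the product of the signs met on the way from y 0 to y i. *)
have [sg [sg0 sgP sgE]] : exists sg : nat -> int, [/\ sg 0%N = 1,
    forall i, (i <= q)%N -> sg i = 1 \/ sg i = -1 &
    forall i, (i < q)%N -> br E (y i) *~ sg i = y i.+1 *~ sg i.+1 *+ i.+1].
  elim: {-2}q (leqnn q) => [|k IHk] kq.
    by exists (fun=> 1); split=> // i _; left.
  have [sg [s0 sP sE]] := IHk (ltnW kq); have [s sE1 Es] := Ey k kq.
  exists (fun i => if (i <= k)%N then sg i else sg k * s); split=> // i.
    move=> _; case: leqP => ik; first exact: sP.
    by case: (sP k (leqnn k)) sE1 => -> [] ->; [left | right | right | left].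
  move=> ik; have [ik'|->] : (i < k)%N \/ i = k by lia.
    by rewrite ik' ltnW // sE.
  rewrite leqnn ltnn Es pmulrn -!mulrzA; congr (_ *~ _).
  by rewrite mulrC mulrA.
pose u i := y i *~ sg i.
have Eu i : (i < q)%N -> br E (u i) = u i.+1 *+ i.+1.
  by move=> iq; rewrite brMz sgE.
have Hu i : (i <= q)%N -> br (br E F) (u i) = u i *~ (2 * i%:Z - q%:Z).
  by move=> iq; rewrite brMz Hy // mulrzAC.
have Fu0 : br F (u 0%N) = 0 by rewrite brMz F0 mul0rz.
have Fu i : (i < q)%N -> br F (u i.+1) = u i *+ (q - i).
  (* [F, [E, u_j]] = [E, [F, u_j]] - [H, u_j] expresses the action of F on u_(j+1) by its action on
     u_j. *)
  have step j v : (j < q)%N -> br E (br F (u j)) = v ->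
      br F (u j.+1) *+ j.+1 = v - u j *~ (2 * j%:Z - q%:Z).
    move=> jq <-; have -> : br F (u j.+1) *+ j.+1 = br F (br E (u j)).
      by rewrite Eu // mulrnAr mulrnAl -mulrnBl.
    by rewrite (br_jacobi E F) Hu ?(ltnW jq) // addrAC subrr add0r.
  elim: i => [|i IHi] iq.
    have := step 0%N 0 iq; rewrite Fu0 mulr0 mul0r subrr => /(_ erefl).
    by rewrite mulr1n => ->; rewrite mulr0 sub0r sub0r -mulrNz opprK subn0.
  apply: (mulrn_algI natK (k := i.+1)); rewrite /= (step _ _ iq (erefl _)).
  rewrite IHi ?(ltnW iq) // [X in br E X]pmulrn brMz Eu ?(ltnW iq) //.
  rewrite !pmulrn -!mulrzA -mulrzBr; congr (_ *~ _).
  have [k qE] : exists k, q = (k + i.+2)%N by exists (q - i.+2)%N; rewrite subnK.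
  by rewrite qE; lia.
have key := nexp_weyl q3 EN FN Eu _ Fu Fu0.
move=> i iq; have := key _ i iq; rewrite brMz Eq mul0rz => /(_ erefl); rewrite -/g => h.
exists (sg i * (-1) ^+ i * sg (q - i)%N).
  have := sgP _ (leq_subr i q); have := sgP _ iq; rewrite -signr_odd.
  by case: odd => -[] -> [] ->; rewrite ?mulr1 ?mul1r; auto.
have s2 : sg i * sg i = 1 by case: (sgP _ iq) => ->.
have -> : y i = u i *~ sg i by rewrite /u -mulrzA s2.
rewrite mulrzAr h /u -mulrzAl -!mulrzA; congr (_ *~ _ * _).
by ring.
Qed.

End NilpotentExponential.

(** * Root strings and pairs of roots *)

Section RootGeometry.
Context (F : realFieldType) (V : vectType F) (dot : {dot V for idfun}).
Context (Phi : root_system dot).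
Implicit Types (a b c d g : V).
Local Notation rt := (rs_roots Phi).

Lemma dotC a b : dot a b = dot b a.
Proof. by rewrite hermC expr0 mul1r. Qed.

Lemma dotDl a b c : dot (a + b) c = dot a c + dot b c.
Proof. exact: linearDl. Qed.

Lemma dotDr a b c : dot c (a + b) = dot c a + dot c b.
Proof. exact: linearDr. Qed.

Lemma dotZl k a b : dot (k *: a) b = k * dot a b.
Proof. exact: linearZl_LR. Qed.

Lemma dotZr k a b : dot a (k *: b) = k * dot a b.
Proof. by rewrite dotC dotZl dotC. Qed.

Lemma dotNl a b : dot (- a) b = - dot a b.
Proof. exact: linearNl. Qed.

Lemma dotNr a b : dot a (- b) = - dot a b.
Proof. exact: linearNr. Qed.

Lemma dotMzl a b (k : int) : dot (a *~ k) b = k%:~R * dot a b.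
Proof. by rewrite -scaler_int dotZl. Qed.

Lemma dotMzr a b (k : int) : dot a (b *~ k) = k%:~R * dot a b.
Proof. by rewrite dotC dotMzl dotC. Qed.

Lemma dot_gt0 a : a != 0 -> 0 < dot a a.
Proof. exact: neq0_dnorm_gt0. Qed.

Lemma root_neq0 a : a \in rt -> a != 0.
Proof. by apply: contraTneq => ->; apply: roots_neq0. Qed.

Lemma dot_root_gt0 a : a \in rt -> 0 < dot a a.
Proof. by move/root_neq0/dot_gt0. Qed.

Lemma cartanE a b (z : int) : a \in rt ->
  cartan dot b a = z%:~R <-> 2 * dot b a = z%:~R * dot a a.
Proof.
move/dot_root_gt0 => a0; rewrite /cartan.
by split=> [<-|->]; [rewrite divfK ?gt_eqF | rewrite mulfK ?gt_eqF].
Qed.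

Lemma cartan_int a b : a \in rt -> b \in rt ->
  exists z : int, 2 * dot b a = z%:~R * dot a a.
Proof.
by move=> aP bP; have [z /cartanE-/(_ aP)] := roots_integral aP bP; exists z.
Qed.

Lemma root_refl a b (z : int) : a \in rt -> b \in rt ->
  2 * dot b a = z%:~R * dot a a -> b - a *~ z \in rt.
Proof.
move=> aP bP /cartanE-/(_ aP) c.
by have := roots_reflection aP bP; rewrite c scaler_int.
Qed.

Lemma root_opp a : (- a \in rt) = (a \in rt).
Proof.
suff N b : b \in rt -> - b \in rt by apply/idP/idP => /N; rewrite ?opprK.
move=> bP; have := @root_refl b b 2 bP bP (erefl _).
by rewrite -[_ *~ 2]/(b *+ 2) mulr2n opprD addrA subrr sub0r.
Qed.

Hypothesis redPhi : reduced Phi.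

(** For two roots of a reduced system this amounts to linear independence, by [nonprop_scale]. *)
Definition nonprop a b := (b != a) && (b != - a).

Lemma nonprop_sym a b : nonprop a b -> nonprop b a.
Proof. by rewrite /nonprop eq_sym => /andP[-> h]; rewrite -eqr_oppLR eq_sym. Qed.

Lemma nonprop_scale a b (k : F) : a \in rt -> b \in rt -> nonprop a b -> b != k *: a.
Proof.
move=> aP bP /andP[n1 n2]; apply/eqP => bE.
have [|k1|k1] := redPhi (c := k) aP; first by rewrite -bE.
- by rewrite bE k1 scale1r eqxx in n1.
- by rewrite bE k1 scaleN1r eqxx in n2.
Qed.

Lemma cauchy_schwarz a b : a \in rt -> b \in rt -> nonprop a b ->
  dot a b ^+ 2 < dot a a * dot b b.
Proof.
move=> aP bP ab; have a0 := dot_root_gt0 aP.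
pose k := dot a b / dot a a; have : 0 < dot (b - k *: a) (b - k *: a).
  by apply: dot_gt0; rewrite subr_eq0 nonprop_scale.
rewrite dotDl !dotDr !dotNl !dotNr !dotZl !dotZr (dotC b a) => h.
have kE : k * dot a a = dot a b by rewrite divfK ?gt_eqF.
rewrite kE in h; have : 0 < (dot b b - k * dot a b) * dot a a by rewrite pmulr_lgt0 //; lra.
by rewrite mulrBl mulrAC kE; lra.
Qed.

(** The product m n is 4 cos^2 of the angle, an integer strictly below 4 by Cauchy-Schwarz. *)
Lemma cartan_prod a b (m n : int) : a \in rt -> b \in rt -> nonprop a b ->
  2 * dot b a = m%:~R * dot a a -> 2 * dot a b = n%:~R * dot b b ->
  [/\ m * n <= 3, (m == 0) = (n == 0) & 0 <= m * n].
Proof.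
move=> aP bP ab mE nE; have := cauchy_schwarz aP bP ab.
have a0 := dot_root_gt0 aP; have b0 := dot_root_gt0 bP; rewrite (dotC b a) in mE.
have h : 4 * dot a b ^+ 2 = (m * n)%:~R * (dot a a * dot b b).
  have -> : 4 * dot a b ^+ 2 = (2 * dot a b) * (2 * dot a b) by ring.
  by rewrite {1}mE nE intrM; ring.
have ab0 : 0 < dot a a * dot b b by rewrite mulr_gt0.
move=> cs; split.
- rewrite -ltzD1 -(ltr_int F) -(ltr_pM2r ab0) -h.
  have -> : (3 + 1)%:~R = 4 :> F by [].
  lra.
- have : (m%:~R == 0 :> F) = (n%:~R == 0 :> F).
    by rewrite -(mulrI_eq0 _ (mulfI (lt0r_neq0 a0))) mulrC -mE nE mulf_eq0 (gt_eqF b0) orbF.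
  by rewrite !intr_eq0.
- by rewrite -(ler_int F) -(ler_pM2r ab0) -h mul0r mulr_ge0 ?sqr_ge0.
Qed.

Lemma cartan_le3 a b (m : int) : a \in rt -> b \in rt -> nonprop a b ->
  2 * dot b a = m%:~R * dot a a -> - 3 <= m <= 3.
Proof.
move=> aP bP ab mE; have [n nE] := cartan_int bP aP.
have [h1 h2 h3] := cartan_prod aP bP ab mE nE.
by nia.
Qed.

(** Two negative Cartan integers with product at most 3 include a -1, and the corresponding
    reflection sends one of the roots to the sum. *)
Lemma root_add a b : a \in rt -> b \in rt -> nonprop a b -> dot a b < 0 -> a + b \in rt.
Proof.
move=> aP bP ab ab0.
have [n nE] := cartan_int bP aP; have [m mE] := cartan_int aP bP.
have [h1 h2 h3] := cartan_prod aP bP ab mE nE.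
have m0 : m < 0.
  by rewrite -(ltr_int F) -(pmulr_llt0 _ (dot_root_gt0 aP)) -mE dotC; lra.
have n0 : n < 0.
  by rewrite -(ltr_int F) -(pmulr_llt0 _ (dot_root_gt0 bP)) -nE; lra.
have [m1|n1] : m = -1 \/ n = -1 by nia.
- by have := root_refl aP bP mE; rewrite m1 mulrNz opprK addrC.
- by have := root_refl bP aP nE; rewrite n1 mulrNz opprK.
Qed.

(** The reflection in g acts on the positions by k -> -m - k, and [root_add] allows a step upwards
    as long as m + 2k < 0. Hence the string is an interval without gaps, symmetric about -m/2. *)
Lemma root_string g d : g \in rt -> d \in rt -> nonprop g d ->
  exists p q : nat, [/\ (p <= q)%N, (q <= 3)%N,
    forall k : int, (d + g *~ k \in rt) = (- p%:Z <= k <= q%:Z - p%:Z) &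
    2 * dot d g = (2 * p%:Z - q%:Z)%:~R * dot g g].
Proof.
move=> gP dP gd; have [m mE] := cartan_int gP dP.
pose S k := d + g *~ k \in rt.
have np k : S k -> nonprop g (d + g *~ k).
  move=> _; apply/andP; split; apply/eqP => e.
  - have := nonprop_scale (1 - k)%:~R gP dP gd.
    by rewrite scaler_int mulrzBr mulr1z -{1}e addrK eqxx.
  - have := nonprop_scale (- 1 - k)%:~R gP dP gd.
    by rewrite scaler_int mulrzBr mulrN1z -e addrK eqxx.
have cS k : 2 * dot (d + g *~ k) g = (m + 2 * k)%:~R * dot g g.
  by rewrite dotDl dotMzl mulrDr mE intrD intrM; ring.
have S0 : S 0 by rewrite /S mulr0z addr0.
have S3 k : S k -> - 3 <= m + 2 * k <= 3.
  by move=> Sk; apply: cartan_le3 (cS k) => //; apply: np.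
have Sr k : S k -> S (- m - k).
  move=> Sk; have := root_refl gP Sk (cS k).
  rewrite -addrA -mulrzBr /S.
  by rewrite (_ : - m - k = k - (m + 2 * k)) //; lia.
have Sinc k : S k -> m + 2 * k < 0 -> S (k + 1).
  move=> Sk h; rewrite /S mulrzDr mulr1z addrA; apply: root_add => //.
    exact/nonprop_sym/np.
  have := cS k; have := dot_root_gt0 gP; rewrite -(ltr_int F) in h.
  move=> g0 e; have : 2 * dot (d + g *~ k) g < 0 by rewrite e pmulr_llt0.
  lra.
have [p pP pmin] : exists2 p : nat, ~~ S (- p.+1%:Z) & forall j : nat, (j <= p)%N -> S (- j%:Z).
  have ex : exists p : nat, ~~ S (- p.+1%:Z).
    (* The bounds |m| <= 3 and |m + 2k| <= 3 force |k| <= 3, so position -7 is outside the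
       string. *)
    by exists 6; apply/negP => /S3; have := S3 _ S0; lia.
  exists (ex_minn ex); case: ex_minnP => // p pP pmin j; case: j => [//|j] jp.
  by apply/negPn/negP => /pmin; lia.
have Sp := pmin _ (leqnn p).
(* If the Cartan integer at the lower end were positive, the mirror image of that end could be
   raised by one and reflected back to position -p - 1. *)
have m0 : m - 2 * p%:Z <= 0.
  rewrite leNgt; apply/negP => h; have S1 : S (- m - - p%:Z + 1).
    by apply: Sinc; [apply: Sr | lia].
  by move/negP: pP; apply; have := Sr _ S1; rewrite (_ : - m - _ = - p.+1%:Z); last lia.
pose q := absz (2 * p%:Z - m)%R.
have qE : q%:Z = 2 * p%:Z - m by rewrite /q; lia.
have := S3 _ Sp => q3; have := S3 _ S0 => m3.
have lo k : S k -> - p%:Z <= k.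
  move=> Sk; rewrite leNgt; apply/negP => h.
  by move/negP: pP; apply; have := S3 _ Sk => h3; rewrite (_ : - _ = k) //; lia.
have hi k : S k -> k <= q%:Z - p%:Z by move/Sr/lo; lia.
exists p, q; split; [|lia| |]; last by rewrite mE qE; congr (_%:~R * _); lia.
  by have := hi _ S0; lia.
have low k : - p%:Z <= k -> 2 * k <= - m + 1 -> S k.
  move=> h1 h2; have [j kE] : exists j : nat, k = j%:Z - p%:Z by exists (absz (k + p%:Z)%R); lia.
  rewrite kE in h2 *; elim: j h2 {h1 k kE} => [|j IHj] h2; first by rewrite sub0r.
  by rewrite (_ : _ - _ = j%:Z - p%:Z + 1); [apply: Sinc; [apply: IHj|]|]; lia.
move=> k; rewrite -/(S k); apply/idP/idP => [Sk|/andP[k1 k2]].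
  by rewrite lo ?hi.
have [h|h] := lerP (2 * k) (- m + 1); first exact: low.
rewrite (_ : k = - m - (- m - k)); last lia.
by apply/Sr/low; lia.
Qed.

End RootGeometry.

(** * The Chevalley commutator formula *)

Lemma lieC n (X Y : 'M[int]_n) : lie X Y = - lie Y X.
Proof. by rewrite /lie opprB. Qed.

Section RootSubgroups.
Context (F : realFieldType) (V : vectType F) (dot : {dot V for idfun}).
Context (Phi : root_system dot) (m : nat) (e : chevalley_rep Phi m.+1).
Implicit Types (a b : V).

Lemma expmx_morph (R1 R2 : comPzRingType) (f : {rmorphism R1 -> R2}) a (x : R1) :
  map_mx f (expmx (e a) x) = expmx (e a) (f x).
Proof.
rewrite /expmx raddf_sum; apply: eq_bigr => k _ /=.
rewrite map_mxZ rmorphXn -map_mx_comp; congr (_ *: _).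
by apply: eq_map_mx => z /=; rewrite rmorph_int.
Qed.

Lemma expmx_out (R : comPzRingType) a (x : R) : a \notin rs_roots Phi ->
  expmx (e a) x = 1.
Proof.
move=> aP; rewrite /expmx big_ord_recl big1 ?addr0 => [|i _].
  by rewrite expr0 scale1r divpow0 map_mx1.
have -> : divpow (e a) (lift ord0 i) = 0.
  by apply: (mulrn_mx_inj (fact_gt0 (lift ord0 i))); rewrite divpowK mul0rn chevalley_out // expr0n.
by rewrite map_mx0 scaler0.
Qed.

Section CharacteristicZero.
Context (K : fieldType).
Hypothesis natK : forall k : nat, k.+1%:R != 0 :> K.
Implicit Types (s t : K).

Definition rvec a : 'M[K]_m.+1 := map_mx intr (e a).

Lemma rvec_nilp a s : (s *: rvec a) ^+ m.+1 = 0.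
Proof. by rewrite exprZn -rmorphXn /= rootvec_nilp map_mx0 scaler0. Qed.

Lemma nexp_rvec a s : nexp m.+1 (s *: rvec a) = expmx (e a) s.
Proof.
apply: eq_bigr => k _; rewrite exprZn scalerA mulrC -scalerA; congr (_ *: _).
rewrite -rmorphXn /= -divpowK raddfMn /= -scaler_nat scalerA.
by rewrite mulVf ?scale1r // natK_fact.
Qed.

Lemma rvec_lie a b s t : s *: rvec a * (t *: rvec b) - t *: rvec b * (s *: rvec a) =
  (s * t) *: map_mx intr (lie (e a) (e b)).
Proof.
rewrite /lie rmorphB !rmorphM /= -!scalerAl -!scalerAr !scalerA [t * s]mulrC.
by rewrite -scalerBr.
Qed.

End CharacteristicZero.

(** * Transfer of identities between words in root elements from the fraction field of Z[s, t] *)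

Section BivariateTransfer.
Local Notation R0 := {poly {poly int}}.
Local Notation K := {fraction R0}.

Lemma natK_frac k : k.+1%:R != 0 :> K.
Proof.
rewrite -[k.+1%:R](rmorph_nat (@tofrac R0)) tofrac_eq0.
by rewrite -!polyC_natr !polyC_eq0 pnatr_eq0.
Qed.

Lemma eval2 (R : comNzRingType) (s t : R) :
  exists f : {rmorphism R0 -> R}, f 'X = s /\ f ('X%:P) = t.
Proof.
pose g : {rmorphism {poly int} -> R} := horner_morph (fun z : int => mulrC t z%:~R).
pose f : {rmorphism R0 -> R} := horner_morph (fun z : {poly int} => mulrC s (g z)).
exists f; split; first exact: (horner_morphX (fun z : {poly int} => mulrC s (g z))).
have -> : f 'X%:P = g 'X := horner_morphC (fun z : {poly int} => mulrC s (g z)) _.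
exact: (horner_morphX (fun z : int => mulrC t z%:~R)).
Qed.


(* The letter [(a, (k, i, j))] stands for the root element [x_a (k s^i t^j)]. *)
Definition wordmx (R : comPzRingType) (s t : R) (w : seq (V * (int * nat * nat))) :=
  \prod_(x <- w) expmx (e x.1) (x.2.1.1%:~R * s ^+ x.2.1.2 * t ^+ x.2.2).

Lemma wordmx_morph (R1 R2 : comPzRingType) (f : {rmorphism R1 -> R2}) s t w :
  map_mx f (wordmx s t w) = wordmx (f s) (f t) w.
Proof.
rewrite /wordmx rmorph_prod; apply: eq_bigr => x _ /=.
by rewrite expmx_morph !rmorphM !rmorphXn rmorph_int.
Qed.

Lemma wordmx_transfer w1 w2 :
  (forall s t : K, wordmx s t w1 = wordmx s t w2) ->
  forall (R : comNzRingType) (s t : R), wordmx s t w1 = wordmx s t w2.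
Proof.
move=> wK R s t; have [f [<- <-]] := eval2 s t.
rewrite -!wordmx_morph; congr map_mx.
have := wK (tofrac 'X) (tofrac 'X%:P); rewrite -!wordmx_morph.
by move/matrixP => h; apply/matrixP => i j; have := h i j; rewrite !mxE => /eqP; rewrite tofrac_eq => /eqP.
Qed.

End BivariateTransfer.

Definition letter a (k : int) (i j : nat) : V * (int * nat * nat) := (a, (k, i, j)).

(* [a_j] stands for [a_0 + j b] and [f_j] for [2 a_0 + j b]; whatever is not a root
   may be replaced by the vector 0, where [e] vanishes. *)
Section CommutatorFormula.
Variables (b a0 a1 a2 a3 f1 f3 : V) (N1 N2 N3 M1 M3 c03 c12 : int).
Hypotheses (hb0 : lie (e b) (e a0) = e a1 *~ N1)
  (hb1 : lie (e b) (e a1) *~ N1 = e a2 *~ (2 * N2))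
  (hb2 : lie (e b) (e a2) *~ N2 = e a3 *~ (3 * N3))
  (hb3 : lie (e b) (e a3) *~ N3 = 0)
  (h01 : lie (e a0) (e a1) *~ N1 = e f1 *~ (- (2 * M1)))
  (h02 : lie (e a0) (e a2) *~ N2 = 0)
  (h03 : lie (e a0) (e a3) *~ N3 = e f3 *~ c03)
  (h12 : lie (e a1) (e a2) *~ (N1 * N2) = e f3 *~ c12)
  (h13 : lie (e a1) (e a3) *~ (N1 * N3) = 0)
  (h23 : lie (e a2) (e a3) *~ (N2 * N3) = 0)
  (hc : c03 + c12 = - (2 * M3))
  (hff : lie (e f1) (e f3) = 0)
  (hf0 : lie (e a0) (e f1) = 0 /\ lie (e a0) (e f3) = 0)
  (hf1 : lie (e a1) (e f1) *~ N1 = 0 /\ lie (e a1) (e f3) *~ N1 = 0)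
  (hf2 : lie (e a2) (e f1) *~ N2 = 0 /\ lie (e a2) (e f3) *~ N2 = 0)
  (hf3 : lie (e a3) (e f1) *~ N3 = 0 /\ lie (e a3) (e f3) *~ N3 = 0).

Section Field.
Context (K : fieldType).
Hypothesis natK : forall k : nat, k.+1%:R != 0 :> K.
Implicit Types s t x y : K.
Local Notation E := (rvec K).

(** The integer k stays attached to the bracket instead of being divided out, so a vanishing
    coefficient is no special case; y is the monomial left over from x x'. *)
Lemma rvec_lieE a a' x x' (X : 'M[int]_m.+1) k l y :
  lie (e a) (e a') *~ k = X *~ l -> x * x' = k%:~R * y ->
  x *: E a * (x' *: E a') - x' *: E a' * (x *: E a) = (l%:~R * y) *: map_mx intr X.
Proof.
move=> h xy; have mapZ (Z : 'M[int]_m.+1) (i : int) :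
    i%:~R *: map_mx intr Z = map_mx intr (Z *~ i) :> 'M[K]_m.+1.
  by rewrite scaler_int raddfMz.
by rewrite rvec_lie xy (mulrC k%:~R) -(scalerA y) mapZ h -mapZ scalerA mulrC.
Qed.

Lemma rvec_comm a a' x x' k y :
  lie (e a) (e a') *~ k = 0 -> x * x' = k%:~R * y ->
  x *: E a * (x' *: E a') = x' *: E a' * (x *: E a).
Proof.
move=> h xy; apply/subr0_eq; rewrite (@rvec_lieE _ _ _ _ 0 k 0 y) ?h ?mul0rz //.
by rewrite mul0r scale0r.
Qed.

(** Apply [nexp_heisenberg] to g = exp(t e_b) and A0 = s e_{a_0}: the A_j are the divided powers of
    ad(t e_b) on A0, and the W_j account for the brackets among them. *)
Lemma commutator_word_field s t :
  wordmx s t [:: letter b 1 0 1; letter a0 1 1 0] =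
  wordmx s t [:: letter a0 1 1 0; letter a1 N1 1 1; letter a2 N2 1 2; letter a3 N3 1 3;
    letter f1 M1 2 1; letter f3 M3 2 3; letter b 1 0 1].
Proof.
pose A0 := s *: E a0; pose A1 := (N1%:~R * s * t) *: E a1.
pose A2 := (N2%:~R * s * t ^+ 2) *: E a2; pose A3 := (N3%:~R * s * t ^+ 3) *: E a3.
pose W1 := (M1%:~R * s ^+ 2 * t) *: E f1; pose W3 := (M3%:~R * s ^+ 2 * t ^+ 3) *: E f3.
pose Z03 := (c03%:~R * (s ^+ 2 * t ^+ 3)) *: E f3.
pose Z12 := (c12%:~R * (s ^+ 2 * t ^+ 3)) *: E f3.
have gE : nexp m.+1 (t *: E b) * A0 = (A0 + A1 + A2 + A3) * nexp m.+1 (t *: E b).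
  apply: (nexp_ad natK); first exact: rvec_nilp.
  - rewrite (@rvec_lieE _ _ _ _ (e a1) 1 N1 (s * t)) ?hb0 ?mulr1z //; last by ring.
    by rewrite mulrA.
  - rewrite (rvec_lieE (y := s * t ^+ 2) hb1); last by ring.
    by rewrite /A2 -scaler_nat scalerA intrM; congr (_ *: _); ring.
  - rewrite (rvec_lieE (y := s * t ^+ 3) hb2); last by ring.
    by rewrite /A3 -scaler_nat scalerA intrM; congr (_ *: _); ring.
  - by apply/eqP; rewrite subr_eq0; apply/eqP/(rvec_comm (y := s * t ^+ 4) hb3); ring.
have com i x k : lie (e i) (e f1) *~ k = 0 /\ lie (e i) (e f3) *~ k = 0 ->
    forall y, (k%:~R * x) *: E i * (y *: E f1) = y *: E f1 * ((k%:~R * x) *: E i) /\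
    (k%:~R * x) *: E i * (y *: E f3) = y *: E f3 * ((k%:~R * x) *: E i).
  case=> h1 h3 y; split.
    by apply: (rvec_comm (y := x * y) h1); ring.
  by apply: (rvec_comm (y := x * y) h3); ring.
have key := @nexp_heisenberg _ _ natK m.+1 (nexp m.+1 (t *: E b)) _ A0 A1 A2 A3 W1 W3 Z03 Z12.
have := key _ (rvec_nilp _ _) (rvec_nilp _ _) (rvec_nilp _ _) (rvec_nilp _ _)
  (rvec_nilp _ _) (rvec_nilp _ _) _ _ _ _ _ _ _ _ _ (erefl _) gE.
rewrite !nexp_rvec // /wordmx !big_cons !big_nil /letter /= ?mulr1z ?expr0 ?expr1 ?mul1r ?mulr1.
rewrite !mulrA; apply.
- rewrite (rvec_lieE (y := s ^+ 2 * t) h01); last by ring.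
  by rewrite /W1 -scaler_nat scalerA -scaleNr intrN intrM; congr (_ *: _); ring.
- by apply: (rvec_comm (y := s ^+ 2 * t ^+ 2) h02); ring.
- by rewrite (rvec_lieE (y := s ^+ 2 * t ^+ 3) h03) //; ring.
- by rewrite (rvec_lieE (y := s ^+ 2 * t ^+ 3) h12) //; ring.
- by apply: (rvec_comm (y := s ^+ 2 * t ^+ 4) h13); ring.
- by apply: (rvec_comm (y := s ^+ 2 * t ^+ 5) h23); ring.
- rewrite /Z03 /Z12 /W3 -scalerDl -mulrDl -intrD hc -scaler_nat scalerA -scaleNr.
  by rewrite intrN intrM; congr (_ *: _); ring.
- have hff1 : lie (e f1) (e f3) *~ 1 = 0 by rewrite hff mul0rz.
  by apply: (rvec_comm (y := M1%:~R * M3%:~R * s ^+ 4 * t ^+ 4) hff1); ring.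
- have hf0' : lie (e a0) (e f1) *~ 1 = 0 /\ lie (e a0) (e f3) *~ 1 = 0.
    by rewrite !mulr1z.
  move=> B; rewrite !inE => /or4P[] /eqP ->; rewrite /A0 /A1 /A2 /A3 -?(mulrA _ s).
  + by split; have := com _ s _ hf0'; rewrite mul1r => com0; apply com0.
  + by split; apply (com _ (s * t) _ hf1).
  + by split; apply (com _ (s * t ^+ 2) _ hf2).
  + by split; apply (com _ (s * t ^+ 3) _ hf3).
Qed.
End Field.

Lemma commutator_word (R : comNzRingType) (s t : R) :
  wordmx s t [:: letter b 1 0 1; letter a0 1 1 0] =
  wordmx s t [:: letter a0 1 1 0; letter a1 N1 1 1; letter a2 N2 1 2; letter a3 N3 1 3;
    letter f1 M1 2 1; letter f3 M3 2 3; letter b 1 0 1].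
Proof. exact/wordmx_transfer/commutator_word_field/natK_frac. Qed.

End CommutatorFormula.
End RootSubgroups.

(** * Integer combinations of two independent roots and the possible Gram matrices *)

Section RankTwo.
Context (F : realFieldType) (V : vectType F) (dot : {dot V for idfun}).
Context (Phi : root_system dot) (redPhi : reduced Phi).
Local Notation rt := (rs_roots Phi).
Variables (a b : V).
Hypotheses (aP : a \in rt) (bP : b \in rt) (ab : nonprop a b).
Local Notation L i j := (a *~ i%R + b *~ j%R).

Lemma lincomb_eq0 (i j : int) : L i j = 0 -> (i == 0) && (j == 0).
Proof.
move=> h; have [j0|j0] := eqVneq j 0.
  move: h; rewrite j0 mulr0z addr0 -scaler_int => /eqP.
  by rewrite scaler_eq0 intr_eq0 (negPf (root_neq0 aP)) orbF andbT.
have jF : j%:~R != 0 :> F by rewrite intr_eq0.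
have := nonprop_scale redPhi (- (i%:~R / j%:~R)) aP bP ab.
rewrite -(inj_eq (scalerI jF)) scalerA mulrN mulrCA divff // mulr1 scaleNr !scaler_int.
by rewrite -addr_eq0 addrC h eqxx.
Qed.

Lemma lincombB (i j k l : int) : L i j - L k l = L (i - k) (j - l).
Proof. by rewrite !mulrzBr opprD addrACA. Qed.

Lemma lincombD (i j k l : int) : L i j + L k l = L (i + k) (j + l).
Proof. by rewrite !mulrzDr addrACA. Qed.

Lemma lincombM (i j k : int) : L i j *~ k = L (i * k) (j * k).
Proof. by rewrite mulrzDl !mulrzA. Qed.

Lemma lincomb_nonprop (i j k l : int) : (i, j) != (k, l) -> (i, j) != (- k, - l) ->
  nonprop (L i j) (L k l).
Proof.
rewrite !xpair_eqE => n1 n2; apply/andP; split; apply/eqP => h.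
- have := lincomb_eq0 (i := i - k) (j := j - l).
  by rewrite -lincombB h subrr !subr_eq0 (negPf n1) => /(_ erefl).
- have := lincomb_eq0 (i := i + k) (j := j + l).
  by rewrite -lincombD h subrr !addr_eq0 (negPf n2) => /(_ erefl).
Qed.

Lemma mult_nonroot (i j k : int) : L i j \in rt -> 1 < k -> L (i * k) (j * k) \notin rt.
Proof.
move=> h k1; rewrite -lincombM -scaler_int; apply/negP => h2.
have k1F : 1 < k%:~R :> F by rewrite ltr1z.
by have [e|e] := redPhi h h2; move: k1F; rewrite e ?ltxx // ltNge (le_trans (lerN10 _) ler01).
Qed.

(* The Gram matrix of [a, b] in units of [dot b b]; [n] is <b, a^\vee>. *)
Definition gram (r n : int) :=
  dot a a = r%:~R * dot b b /\ 2 * dot a b = (r * n)%:~R * dot b b.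

(** If c = i a + j b is a root, its squared length q divides 2 (a, c) and 2 (b, c), everything in
    units of (b, b). For numerical r, n, i, j the failure of divisibility is decided by
    computation. *)
Lemma gram_nonroot (r n i j : int) : gram r n ->
  let q := r * i ^+ 2 + r * n * i * j + j ^+ 2 in
  ~~ ((q %| r * (2 * i + n * j))%Z && (q %| r * n * i + 2 * j)%Z) ->
  L i j \notin rt.
Proof.
move=> [h1 h2] q; apply: contraNN => gP.
have y0 := dot_root_gt0 bP.
have gg : dot (L i j) (L i j) = q%:~R * dot b b.
  rewrite dotDl !dotDr !dotMzl !dotMzr (dotC _ b a) h1.
  have -> : dot a b = (r * n)%:~R * dot b b / 2 by rewrite -h2; field.
  by rewrite /q !intrD !intrM; field.
have ag : 2 * dot a (L i j) = (r * (2 * i + n * j))%:~R * dot b b.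
  rewrite dotDr !dotMzr h1.
  have -> : dot a b = (r * n)%:~R * dot b b / 2 by rewrite -h2; field.
  by rewrite !intrM !intrD !intrM; field.
have bg : 2 * dot b (L i j) = (r * n * i + 2 * j)%:~R * dot b b.
  rewrite dotDr !dotMzr (dotC _ b a).
  have -> : dot a b = (r * n)%:~R * dot b b / 2 by rewrite -h2; field.
  by rewrite !intrD !intrM; field.
have [z1] := cartan_int gP aP; have [z2] := cartan_int gP bP.
rewrite ag bg gg !mulrA -!intrM => /(mulIf (lt0r_neq0 y0))/intr_inj -> /(mulIf (lt0r_neq0 y0))/intr_inj ->.
by rewrite !dvdz_mull.
Qed.

(** The list consists of equal lengths at 120 degrees, the angles 135 (B_2) and 150 (G_2), and equal
    lengths at 90 or 60 degrees. Angles of 45 and 30 degrees are excluded because a + b is then not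
    a root. *)
Lemma gram_cases : dot b b <= dot a a -> a + b \in rt ->
  exists r n : int, gram r n /\ (r, n) \in [:: (1, -1); (2, -1); (3, -1); (1, 0); (1, 1)].
Proof.
move=> ba abP; have [n nE] := cartan_int aP bP; have [c cE] := cartan_int bP aP.
have [h1 h2 h3] := cartan_prod redPhi aP bP ab nE cE.
have x0 := dot_root_gt0 aP; have y0 := dot_root_gt0 bP.
have nc : n%:~R * dot a a = c%:~R * dot b b by rewrite -nE -cE dotC.
have nc' : `|n| <= `|c|.
  rewrite -(ler_int F) !intr_norm -(ler_pM2r y0).
  rewrite -{2}(gtr0_norm y0) -normrM -nc normrM (gtr0_norm x0).
  by rewrite ler_wpM2l.
have [n0|[n1|n1]] : n = 0 \/ n = 1 \/ n = -1 by nia.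
(* For orthogonal roots the Cartan integer 2 (a, a) / ((a, a) + (b, b)) lies strictly between 0 and
   2, hence equals 1, and the lengths agree. *)
- exists 1, 0; split; last by [].
  have c0 : c = 0 by apply/eqP; rewrite -h2 n0.
  have d0 : dot a b = 0 by move: cE; rewrite c0 mul0r; lra.
  split; last by rewrite d0 mulr0 mulr0 mul0r.
  have [z] := cartan_int abP aP; rewrite dotDl !dotDr (dotC _ b a) d0 addr0 add0r => zE.
  have z1 : 0 < z.
    by rewrite -(ltr_int F) -(pmulr_lgt0 _ (_ : 0 < dot a a + dot b b)) -?zE; lra.
  have z2 : z < 2.
    by rewrite -(ltr_int F) -(ltr_pM2r (_ : 0 < dot a a + dot b b)) -?zE; lra.
  by move: zE; rewrite (_ : z = 1) ?mulr1z ?mul1r; [lra | lia].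
- have g : gram c 1 by rewrite /gram mulr1 cE -nc n1 mulr1z mul1r.
  have c13 : c = 1 \/ c = 2 \/ c = 3 by nia.
  exists c, 1; split=> //; case: c13 => [->//|[] c23]; exfalso; rewrite c23 in g.
    by have := @gram_nonroot 2 1 1 1 g isT; rewrite !mulr1z abP.
  by have := @gram_nonroot 3 1 1 1 g isT; rewrite !mulr1z abP.
- have c13 : c = -1 \/ c = -2 \/ c = -3 by nia.
  exists (- c), (- 1); split.
    by rewrite /gram mulrNN mulr1 cE intrN mulNr -nc n1 mulrN1z mulN1r opprK.
  by case: c13 => [->|[->|->]].
Qed.

End RankTwo.

Lemma string_bounds (p q : nat) : (p <= q)%N -> (q <= 3)%N -> 2 * p%:Z - q%:Z = -1 ->
  (p = 0%N /\ q = 1%N) \/ (p = 1%N /\ q = 3%N).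
Proof. lia. Qed.

(** * Brackets of root vectors and the commutator formula for each kind of pair *)

Section LieRelations.
Context (F : realFieldType) (V : vectType F) (dot : {dot V for idfun}).
Context (Phi : root_system dot) (redPhi : reduced Phi) (m : nat).
Context (e : chevalley_rep Phi m.+1).
Local Notation rt := (rs_roots Phi).
Implicit Types (a b g d : V).

Lemma lie_nonroot a b : a + b != 0 -> a + b \notin rt -> lie (e a) (e b) = 0.
Proof.
have [aP|aP] := boolP (a \in rt); last first.
  by rewrite (chevalley_out e aP) /lie mul0r mulr0 subrr.
have [bP|bP] := boolP (b \in rt); first exact: chevalley_comm.
by rewrite (chevalley_out e bP) /lie mul0r mulr0 subrr.
Qed.

(** Since the string is an interval, its lower end is recognised by testing the two positions p and
    p + 1. *)
Lemma lie_root g d (p : nat) : g \in rt -> d \in rt -> nonprop g d ->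
  g + d \in rt -> d - g *~ p%:Z \in rt -> d - g *~ p.+1%:Z \notin rt ->
  exists2 s : int, s = 1 \/ s = -1 & lie (e g) (e d) = e (g + d) *~ (s * p.+1%:Z).
Proof.
move=> gP dP gd gdP pP pP'.
have [p0 [q [pq _ str _]]] := root_string redPhi gP dP gd.
have p0E : p0 = p.
  by move: pP pP'; rewrite -!mulrNz !str; lia.
have sd : string_down Phi g d p.
  split; first by rewrite pmulrn.
  by move=> k; rewrite pmulrn -mulrNz str; lia.
have [->|->] := chevalley_add e gP dP gdP sd.
  by exists 1; [left | rewrite mul1r].
by exists (-1); [right | rewrite mulN1r mulrNz].
Qed.

Lemma lie_root_ex g d : g \in rt -> d \in rt -> nonprop g d -> g + d \in rt ->
  exists c : int, lie (e g) (e d) = e (g + d) *~ c.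
Proof.
move=> gP dP gd gdP; have [p [q [pq _ str _]]] := root_string redPhi gP dP gd.
have [|| s _ ->] := @lie_root g d p gP dP gd gdP; last by exists (s * p.+1%:Z).
- by rewrite -mulrNz str; lia.
- by rewrite -mulrNz str; lia.
Qed.

Section Pair.
Variables (a b : V).
Hypotheses (aP : a \in rt) (bP : b \in rt) (ab : nonprop a b).
Local Notation L i j := (a *~ i%R + b *~ j%R).

Lemma lie_lincomb0 (i j k l : int) : (i + k, j + l) != (0, 0) -> L (i + k) (j + l) \notin rt ->
  lie (e (L i j)) (e (L k l)) = 0.
Proof.
move=> n0 nP; apply: lie_nonroot; rewrite lincombD //.
by apply: contraNneq n0 => /(lincomb_eq0 redPhi aP bP ab); rewrite xpair_eqE.
Qed.

Lemma lie_lincomb (p : nat) (i j k l : int) :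
  L i j \in rt -> L k l \in rt -> (i, j) != (k, l) -> (i, j) != (- k, - l) ->
  L (i + k) (j + l) \in rt -> L (k - i * p%:Z) (l - j * p%:Z) \in rt ->
  L (k - i * p.+1%:Z) (l - j * p.+1%:Z) \notin rt ->
  exists2 s : int, s = 1 \/ s = -1 &
    lie (e (L i j)) (e (L k l)) = e (L (i + k) (j + l)) *~ (s * p.+1%:Z).
Proof.
move=> ijP klP n1 n2 sP pP pP'; rewrite -lincombD.
apply: lie_root; rewrite ?lincombM ?lincombB ?lincombD //.
exact: (lincomb_nonprop redPhi).
Qed.

(** The exponents of s and t in the letter are the coefficients of a and b in its root; thus s in A
    and t in B put the parameter in AB. *)
Definition higher_letter (x : V * (int * nat * nat)) :=
  let: (i, j) := (x.2.1.2, x.2.2) in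
  [&& x.1 == a *+ i + b *+ j, (0 < i)%N, (0 < j)%N & (i, j) != (1, 1)%N].

(** The shape x_b x_a = x_a ... x_b is the one delivered by the Heisenberg identity. Only the
    coefficient at a + b is tied to a bracket; those of the higher letters are left open. *)
Definition commutator_formula := exists (c : int) (w : seq (V * (int * nat * nat))),
  [/\ lie (e b) (e a) = e (a + b) *~ c, all higher_letter w &
  forall (R : comNzRingType) (s t : R),
    wordmx e s t [:: letter b 1 0 1; letter a 1 1 0] =
    wordmx e s t ([:: letter a 1 1 0; letter (a + b) c 1 1] ++ w ++ [:: letter b 1 0 1])].

Lemma rootvec0 : e 0 = 0.
Proof. exact/chevalley_out/roots_neq0. Qed.

Lemma commutator_formula_nonroot : a + b \notin rt -> commutator_formula.
Proof.
move=> nP; have nz : b + a != 0.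
  by rewrite addrC addr_eq0; have /andP[_] := nonprop_sym ab.
have h : lie (e b) (e a) = 0 by rewrite lie_nonroot // addrC.
exists 0, [::]; split=> //.
move=> R s t; rewrite (@commutator_word _ _ _ _ _ e b a 0 0 0 0 0 0 0 0 0 0 0 0).
all: rewrite ?rootvec0 ?h /lie ?mulr0 ?mul0r ?subrr ?mul0rz ?mulr0z ?addr0 ?oppr0 //.
by rewrite /wordmx !big_cons big_nil /= !mul0r !expmx0 !mul1r.
Qed.


Lemma lincomb10 : L 1 0 = a. Proof. by rewrite mulr1z mulr0z addr0. Qed.
Lemma lincomb01 : L 0 1 = b. Proof. by rewrite mulr1z mulr0z add0r. Qed.
Lemma lincomb11 : L 1 1 = a + b. Proof. by rewrite !mulr1z. Qed.

Lemma sign_sqr (s : int) : s = 1 \/ s = -1 -> s * s = 1.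
Proof. by case=> ->. Qed.

Section SumRoot.
Hypothesis abP : L 1 1 \in rt.

Let aLP : L 1 0 \in rt. Proof. by rewrite lincomb10. Qed.
Let bLP : L 0 1 \in rt. Proof. by rewrite lincomb01. Qed.

(** Besides two roots at 120 degrees this covers two short roots whose sum is long, in B_2 or
    G_2. *)
Lemma commutator_formula_A2 : L 1 2 \notin rt -> L 2 1 \notin rt -> commutator_formula.
Proof.
move=> n12 n21.
have [c hc] : exists c, lie (e (L 0 1)) (e (L 1 0)) = e (L 1 1) *~ c.
  rewrite lincomb10 lincomb01 lincomb11 addrC; apply: lie_root_ex => //.
    exact: nonprop_sym.
  by rewrite addrC -lincomb11.
have h12 := @lie_lincomb0 0 1 1 1 isT n12.
have h21 := @lie_lincomb0 1 0 1 1 isT n21.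
have W (R : comNzRingType) (s t : R) :
    wordmx e s t [:: letter (L 0 1) 1 0 1; letter (L 1 0) 1 1 0] =
    wordmx e s t [:: letter (L 1 0) 1 1 0; letter (L 1 1) c 1 1; letter (L 0 1) 1 0 1].
  rewrite (@commutator_word _ _ _ _ _ e (L 0 1) (L 1 0) (L 1 1) 0 0 0 0 c 0 0 0 0 0 0).
  all: rewrite ?hc ?rootvec0 ?h12 ?h21 /lie ?mulr0 ?mul0r ?subrr ?mul0rz ?mulr0z ?addr0 ?oppr0 //.
  by rewrite /wordmx !big_cons big_nil /= !mul0r !expmx0 !mul1r.
rewrite lincomb10 lincomb01 lincomb11 in hc W.
by exists c, [::].
Qed.

(** As a - b is not a root, the constants along a, a + b, a + 2b are 1 and 2 up to sign, and the
    divided power at a + 2b has coefficient s1 s2. *)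
Lemma commutator_formula_B2 : gram dot a b 2 (-1) -> commutator_formula.
Proof.
move=> g.
have n i j := gram_nonroot aP bP (i := i) (j := j) g.
have n1N : L 1 (-1) \notin rt by apply: n.
have n13 : L 1 3 \notin rt by apply: n.
have n21 : L 2 1 \notin rt by apply: n.
have n23 : L 2 3 \notin rt by apply: n.
have n22 := mult_nonroot redPhi (i := 1) (j := 1) (k := 2) abP isT.
have L12 : L 1 2 \in rt.
  have := root_refl (z := -2) bP aP; rewrite mulr1z mulrNz opprK; apply.
  by case: g => _ ->.
have [s1 /sign_sqr s11 h1] := @lie_lincomb 0 0 1 1 0 bLP aLP isT isT abP aLP n1N.
have [s2 _ h2] := @lie_lincomb 1 0 1 1 1 bLP abP isT isT L12 aLP n1N.
have h13 := @lie_lincomb0 0 1 1 2 isT n13.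
have h21 := @lie_lincomb0 1 0 1 1 isT n21.
have h22 := @lie_lincomb0 1 0 1 2 isT n22.
have h23 := @lie_lincomb0 1 1 1 2 isT n23.
rewrite mulr1 in h1.
have W (R : comNzRingType) (s t : R) :
    wordmx e s t [:: letter (L 0 1) 1 0 1; letter (L 1 0) 1 1 0] =
    wordmx e s t [:: letter (L 1 0) 1 1 0; letter (L 1 1) s1 1 1;
      letter (L 1 2) (s1 * s2) 1 2; letter (L 0 1) 1 0 1].
  rewrite (@commutator_word _ _ _ _ _ e (L 0 1) (L 1 0) (L 1 1) (L 1 2) 0 0 0
    s1 (s1 * s2) 0 0 0 0 0).
  all: rewrite ?h1 ?h2 ?h13 ?h21 ?h22 ?h23 ?rootvec0 -?mulrzA.
  all: rewrite /lie ?mulr0 ?mul0r ?subrr ?mul0rz ?mulr0z ?addr0 ?oppr0 //.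
    by rewrite /wordmx !big_cons big_nil /= !mul0r !expmx0 !mul1r.
  by congr (_ *~ _); ring.
rewrite lincomb10 lincomb01 lincomb11 in h1 W.
exists s1, [:: letter (L 1 2) (s1 * s2) 1 2]; split=> //.
by rewrite /= andbT /higher_letter /= eqxx.
Qed.

(** The root 2a + b rules out p = 0, q = 1 for the a-string through b, so p = 1, q = 3; then a - b
    is a root and the b-string through a has the same shape. The constants are 2 and 3 up to sign,
    and 2 times 3 halved gives the coefficients 3 at a + 2b and 2a + b. *)
Lemma commutator_formula_G2_short : gram dot a b 1 (-1) -> L 2 1 \in rt -> commutator_formula.
Proof.
move=> g L21.
have n i j := gram_nonroot aP bP (i := i) (j := j) g.
have n23 : L 2 3 \notin rt by apply: n.
have n31 : L 3 1 \notin rt by apply: n.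
have n32 : L 3 2 \notin rt by apply: n.
have n22 := mult_nonroot redPhi (i := 1) (j := 1) (k := 2) abP isT.
have n33 := mult_nonroot redPhi (i := 1) (j := 1) (k := 3) abP isT.
have [p [q [pq q3 str ab2]]] := root_string redPhi aP bP ab.
have [p' [q' [pq' q3' str' ba2]]] := root_string redPhi bP aP (nonprop_sym ab).
have sE k : (L k 1 \in rt) = (- p%:Z <= k <= q%:Z - p%:Z) by rewrite -str mulr1z addrC.
have sE' k : (L 1 k \in rt) = (- p'%:Z <= k <= q'%:Z - p'%:Z) by rewrite -str' mulr1z.
case: (g); rewrite mul1r => g1 g2; rewrite (dotC dot b a) g1 mul1r g2 in ab2 *.
have b0 := lt0r_neq0 (dot_root_gt0 bP).
have pqE : 2 * p%:Z - q%:Z = -1 by apply/(@intr_inj F)/(mulIf b0); rewrite -ab2.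
have pqE' : 2 * p'%:Z - q'%:Z = -1 by apply/(@intr_inj F)/(mulIf b0); rewrite -ba2 g2.
have [[p0 q1]|[p1 q3E]] := string_bounds pq q3 pqE.
  by move: L21; rewrite sE p0 q1.
have LN11 : L 1 (-1) \in rt.
  have : L (-1) 1 \in rt by rewrite sE p1 q3E.
  have := root_opp Phi (L (-1) 1); rewrite opprD -!mulrNz opprK => <-.
  by [].
have [[p0 q1]|[p1' q3E']] := string_bounds pq' q3' pqE'.
  by move: LN11; rewrite sE' p0 q1.
rewrite {}p1 {}q3E in sE; rewrite {}p1' {}q3E' in sE'.
have [s1 /sign_sqr s11 h1] : exists2 s : int, s = 1 \/ s = -1 &
    lie (e (L 0 1)) (e (L 1 0)) = e (L 1 1) *~ (s * 2).
  by apply: (@lie_lincomb 1 0 1 1 0) => //; rewrite sE'.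
have L12 : L 1 2 \in rt by rewrite sE'.
have [s2 _ h2] : exists2 s : int, s = 1 \/ s = -1 &
    lie (e (L 0 1)) (e (L 1 1)) = e (L 1 2) *~ (s * 3).
  by apply: (@lie_lincomb 2 0 1 1 1) => //; rewrite sE'.
have [s3 _ h3] : exists2 s : int, s = 1 \/ s = -1 &
    lie (e (L 1 0)) (e (L 1 1)) = e (L 2 1) *~ (s * 3).
  by apply: (@lie_lincomb 2 1 0 1 1) => //; rewrite sE.
have n13 : L 1 3 \notin rt by rewrite sE'.
have h13 := @lie_lincomb0 0 1 1 2 isT n13.
have h22 := @lie_lincomb0 1 0 1 2 isT n22.
have h23 := @lie_lincomb0 1 1 1 2 isT n23.
have h31 := @lie_lincomb0 1 0 2 1 isT n31.
have h32 := @lie_lincomb0 1 1 2 1 isT n32.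
have h33 := @lie_lincomb0 1 2 2 1 isT n33.
have W (R : comNzRingType) (s t : R) :
    wordmx e s t [:: letter (L 0 1) 1 0 1; letter (L 1 0) 1 1 0] =
    wordmx e s t [:: letter (L 1 0) 1 1 0; letter (L 1 1) (s1 * 2) 1 1;
      letter (L 1 2) (s1 * s2 * 3) 1 2; letter (L 2 1) (- (s1 * s3 * 3)) 2 1;
      letter (L 0 1) 1 0 1].
  rewrite (@commutator_word _ _ _ _ _ e (L 0 1) (L 1 0) (L 1 1) (L 1 2) 0 (L 2 1) 0
    (s1 * 2) (s1 * s2 * 3) 0 (- (s1 * s3 * 3)) 0 0 0).
  all: rewrite ?h1 ?h2 ?h3 ?h13 ?h22 ?h23 ?h31 ?h32 ?h33 ?rootvec0 -?mulrzA.
  all: rewrite /lie ?mulr0 ?mul0r ?subrr ?mul0rz ?mulr0z ?addr0 ?oppr0 //.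
  - by rewrite /wordmx !big_cons big_nil /= !mul0r !expmx0 !mul1r.
  - by congr (_ *~ _); ring.
  - by congr (_ *~ _); ring.
rewrite lincomb10 lincomb01 lincomb11 in h1 W.
exists (s1 * 2), [:: letter (L 1 2) (s1 * s2 * 3) 1 2; letter (L 2 1) (- (s1 * s3 * 3)) 2 1].
by split=> //; rewrite /= andbT /higher_letter /= !eqxx.
Qed.

(** Along a, a + b, a + 2b, a + 3b the constants are 1, 2, 3 up to sign, so the divided powers of ad
    e_b have coefficients 1 or -1. The letter at 2a + 3b collects the brackets of e_a with e_(a+3b)
    and of e_(a+b) with e_(a+2b). *)
Lemma commutator_formula_G2_long : gram dot a b 3 (-1) -> commutator_formula.
Proof.
move=> g.
have n i j := gram_nonroot aP bP (i := i) (j := j) g.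
have n1N : L 1 (-1) \notin rt by apply: n.
have n21 : L 2 1 \notin rt by apply: n.
have n25 : L 2 5 \notin rt by apply: n.
have n34 : L 3 4 \notin rt by apply: n.
have n35 : L 3 5 \notin rt by apply: n.
have nN : L (-2) (-1) \notin rt by apply: n.
have n22 := mult_nonroot redPhi (i := 1) (j := 1) (k := 2) abP isT.
have n33 := mult_nonroot redPhi (i := 1) (j := 1) (k := 3) abP isT.
have n03 := mult_nonroot redPhi (i := 0) (j := 1) (k := 3) bLP isT.
have [p' [q' [pq' q3' str' ba2]]] := root_string redPhi bP aP (nonprop_sym ab).
have sE' k : (L 1 k \in rt) = (- p'%:Z <= k <= q'%:Z - p'%:Z) by rewrite -str' mulr1z.
case: (g) => g1 g2; rewrite g2 in ba2.
have b0 := lt0r_neq0 (dot_root_gt0 bP).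
have pqE' : 2 * p'%:Z - q'%:Z = -3 by apply/(@intr_inj F)/(mulIf b0); rewrite -ba2.
have [p0' q3E'] : p' = 0%N /\ q' = 3%N by move: pq' q3' pqE'; clear; lia.
rewrite {}p0' {}q3E' in sE'.
have L12 : L 1 2 \in rt by rewrite sE'.
have L13 : L 1 3 \in rt by rewrite sE'.
have n14 : L 1 4 \notin rt by rewrite sE'.
have n24 := mult_nonroot redPhi (i := 1) (j := 2) (k := 2) L12 isT.
have n36 := mult_nonroot redPhi (i := 1) (j := 2) (k := 3) L12 isT.
have L23 : L 2 3 \in rt.
  have : 2 * dot (L 1 3) a = (-1)%:~R * dot a a.
    rewrite dotDl !dotMzl (dotC dot b a) mulrDr mulrCA [X in _ + X]mulrCA g2 g1; ring.
  move=> /(root_refl aP L13); rewrite mulrNz opprK mulr1z.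
  by rewrite [(a + b *~ 3) + a]addrAC.
have LN10 : L (-1) 0 \in rt by rewrite mulr0z addr0 mulrNz mulr1z root_opp.
have [s1 s1E h1] := @lie_lincomb 0 0 1 1 0 bLP aLP isT isT abP aLP n1N.
have [s2 s2E h2] := @lie_lincomb 1 0 1 1 1 bLP abP isT isT L12 aLP n1N.
have [s3 s3E h3] := @lie_lincomb 2 0 1 1 2 bLP L12 isT isT L13 aLP n1N.
have [s4 s4E h4] := @lie_lincomb 0 1 0 1 3 aLP L13 isT isT L23 L13 n03.
have [s5 s5E h5] := @lie_lincomb 2 1 1 1 2 abP L12 isT isT L23 LN10 nN.
have /sign_sqr s11 := s1E; have /sign_sqr s22 := s2E.
have h14 := @lie_lincomb0 0 1 1 3 isT n14.
have h21 := @lie_lincomb0 1 0 1 1 isT n21.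
have h22 := @lie_lincomb0 1 0 1 2 isT n22.
have h24 := @lie_lincomb0 1 1 1 3 isT n24.
have h25 := @lie_lincomb0 1 2 1 3 isT n25.
have h33 := @lie_lincomb0 1 0 2 3 isT n33.
have h34 := @lie_lincomb0 1 1 2 3 isT n34.
have h35 := @lie_lincomb0 1 2 2 3 isT n35.
have h36 := @lie_lincomb0 1 3 2 3 isT n36.
rewrite mulr1 in h1.
pose N3 := s1 * s2 * s3; pose c03 := N3 * s4; pose c12 := s2 * s5 * 3.
(* The number c03 is 1 or -1 and c12 is 3 or -3, so their sum is even whatever the signs are. *)
have [M3 M3E] : exists M3 : int, c03 + c12 = - (2 * M3).
  rewrite /c03 /c12 /N3.
  case: s1E => ->; case: s2E => ->; case: s3E => ->; case: s4E => ->; case: s5E => ->;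
  by [exists (-2) | exists 1 | exists (-1) | exists 2].
have W (R : comNzRingType) (s t : R) :
    wordmx e s t [:: letter (L 0 1) 1 0 1; letter (L 1 0) 1 1 0] =
    wordmx e s t [:: letter (L 1 0) 1 1 0; letter (L 1 1) s1 1 1;
      letter (L 1 2) (s1 * s2) 1 2; letter (L 1 3) N3 1 3; letter (L 2 3) M3 2 3;
      letter (L 0 1) 1 0 1].
  rewrite (@commutator_word _ _ _ _ _ e (L 0 1) (L 1 0) (L 1 1) (L 1 2) (L 1 3) 0 (L 2 3)
    s1 (s1 * s2) N3 0 M3 c03 c12).
  all: rewrite ?h1 ?h2 ?h3 ?h4 ?h5 ?h14 ?h21 ?h22 ?h24 ?h25 ?h33 ?h34 ?h35 ?h36 ?rootvec0 -?mulrzA.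
  all: rewrite /lie ?mulr0 ?mul0r ?subrr ?mul0rz ?mulr0z ?addr0 ?oppr0 //.
  - by rewrite /wordmx !big_cons big_nil /= !mul0r !expmx0 !mul1r.
  - by congr (_ *~ _); ring.
  - by congr (_ *~ _); rewrite /N3; ring.
  - by congr (_ *~ _); rewrite /c03; ring.
  - by congr (_ *~ _); rewrite -[RHS]mul1r -s11 /c12; ring.
rewrite lincomb10 lincomb01 lincomb11 in h1 W.
exists s1, [:: letter (L 1 2) (s1 * s2) 1 2; letter (L 1 3) N3 1 3; letter (L 2 3) M3 2 3].
by split=> //; rewrite /= andbT /higher_letter /= !eqxx.
Qed.

End SumRoot.
End Pair.
End LieRelations.

Local Notation GLval := Defs.GLval.
Local Notation commutator := Defs.commutator.

(** * The commutator formula for arbitrary independent roots, as an identity of group elements *)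

Section ChevalleyCommutator.
Context (F : realFieldType) (V : vectType F) (dot : {dot V for idfun}).
Context (Phi : root_system dot) (redPhi : reduced Phi) (m : nat).
Context (e : chevalley_rep Phi m.+1).
Local Notation rt := (rs_roots Phi).
Implicit Types (a b g d : V).

(** Taking b no longer than a ensures that the roots i a + j b with i, j > 0 have i <= 2, which is
    the range covered by the letters a + j b and 2a + j b. *)
Lemma commutator_formula_le a b : a \in rt -> b \in rt -> nonprop a b ->
  dot b b <= dot a a -> commutator_formula e a b.
Proof.
move=> aP bP ab ba; have [abP|] := boolP (a + b \in rt); last exact: commutator_formula_nonroot.
have [r [n [g rn]]] := gram_cases redPhi aP bP ab ba abP.
have nr i j := gram_nonroot aP bP (i := i) (j := j) g.
have abP' : a *~ 1 + b *~ 1 \in rt by rewrite !mulr1z.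
move: rn g nr; rewrite !inE !xpair_eqE.
case/or4P => [|||/orP[]] /andP[/eqP-> /eqP->] g nr.
- have [L21|n21] := boolP (a *~ 2 + b *~ 1 \in rt); first exact: commutator_formula_G2_short.
  (* If a + 2b is a root, the b-string through a has p = 1 and q = 3 and contains a - b; hence the
     a-string through b contains b - a, has the same shape, and reaches 2a + b. *)
  apply: commutator_formula_A2 => //; apply: contraNN n21 => L12.
  have [p [q [pq q3 str]]] := root_string redPhi aP bP ab.
  have [p' [q' [pq' q3' str']]] := root_string redPhi bP aP (nonprop_sym ab).
  case: (g); rewrite mul1r (dotC dot b a) => g1 g2; rewrite g1 mul1r g2 => ba2 ab2.
  have b0 := lt0r_neq0 (dot_root_gt0 bP).
  have pqE : 2 * p%:Z - q%:Z = -1 by apply/(@intr_inj F)/(mulIf b0).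
  have pqE' : 2 * p'%:Z - q'%:Z = -1 by apply/(@intr_inj F)/(mulIf b0).
  have [[p0 q1]|[p1 q3E]] := string_bounds pq' q3' pqE'.
    by move: L12; rewrite mulr1z str' p0 q1.
  have [[p0 q1]|[p1' q3E']] := string_bounds pq q3 pqE; last first.
    by rewrite mulr1z addrC str p1' q3E'.
  have : a + b *~ (-1) \in rt by rewrite str' p1 q3E.
  by rewrite -root_opp opprD -mulrNz mulr1z addrC -(mulrN1z a) str p0 q1.
- exact: commutator_formula_B2.
- exact: commutator_formula_G2_long.
- by apply: commutator_formula_A2 => //; apply: nr.
- by apply: commutator_formula_A2 => //; apply: nr.
Qed.

Section Words.
Context (R : comNzRingType).
Implicit Types (s t : R).

Definition gword s t (w : seq (V * (int * nat * nat))) : GL R m.+1 :=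
  (\prod_(x <- w) xroot e x.1 (x.2.1.1%:~R * s ^+ x.2.1.2 * t ^+ x.2.2)%R)%g.

Lemma GLval_gword s t w : GLval (gword s t w) = wordmx e s t w.
Proof.
rewrite /gword /wordmx; elim: w => [|x w IHw]; first by rewrite !big_nil.
by rewrite !big_cons GLvalM IHw.
Qed.

Lemma gword_cons s t x w : gword s t (x :: w) =
  (xroot e x.1 (x.2.1.1%:~R * s ^+ x.2.1.2 * t ^+ x.2.2)%R * gword s t w)%g.
Proof. exact: big_cons. Qed.

Lemma gword_nil s t : gword s t [::] = 1%g.
Proof. exact: big_nil. Qed.

Lemma gword_cat s t w1 w2 : gword s t (w1 ++ w2) = (gword s t w1 * gword s t w2)%g.
Proof. exact: big_cat. Qed.

Lemma xrootD a s t : xroot e a (s + t) = (xroot e a s * xroot e a t)%g.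
Proof. by apply: GLval_inj; rewrite GLvalM /GLval /= expmxD. Qed.

Lemma xroot0 a : xroot e a (0 : R) = 1%g.
Proof. by apply: GLval_inj; rewrite GLval1 /GLval /= expmx0. Qed.

Lemma xrootN a s : xroot e a (- s) = ((xroot e a s)^-1)%g.
Proof. by apply: (mulgI (xroot e a s)); rewrite mulgV -xrootD subrr xroot0. Qed.

End Words.

(** When a is at least as long as b, replacing s by -s turns the formula into a commutator with the
    higher letters on the right. Otherwise one replaces t by -t and inverts, which reverses the word
    and puts them on the left. *)
Lemma chevalley_commutator a b : a \in rt -> b \in rt -> nonprop a b ->
  exists (c : int) (w1 w2 : seq (V * (int * nat * nat))),
  [/\ lie (e a) (e b) = e (a + b) *~ c, all (higher_letter a b) (w1 ++ w2) &
  forall (R : comNzRingType) (s t : R),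
    commutator (xroot e a s) (xroot e b t) =
    (gword s t w1 * xroot e (a + b) (c%:~R * s * t) * gword s t w2)%g].
Proof.
move=> aP bP ab; have [ba|/ltW ba] := lerP (dot b b) (dot a a).
  have [c [w [hc hw W]]] := commutator_formula_le aP bP ab ba.
  pose w' := [seq letter x.1 ((-1) ^+ x.2.1.2 * x.2.1.1) x.2.1.2 x.2.2 | x <- w].
  exists (- c), [::], w'; split.
  - by rewrite lieC hc mulrNz.
  - by rewrite all_map; apply: sub_all hw.
  move=> R s t; have := W R (- s) t; rewrite -!GLval_gword => /(@GLval_inj _ _ _ _).
  have -> : gword (- s) t ([:: letter a 1 1 0; letter (a + b) c 1 1] ++ w ++ [:: letter b 1 0 1]) =
     (xroot e a (- s) * xroot e (a + b) ((- c)%:~R * s * t) * gword s t w' * xroot e b t)%g.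
    rewrite !gword_cat !gword_cons !gword_nil /= !expr0 !expr1 !mul1r !mulr1 !mulg1.
    rewrite mulrN mulNr intrN mulNr mulNr !mulgA; congr (_ * _ * _)%g.
    rewrite /gword big_map; apply: eq_bigr => x _ /=; congr xroot.
    by rewrite (exprNn s) intrM intr_sign mulrCA mulrA.
  rewrite !gword_cons !gword_nil /= !expr0 !expr1 !mul1r !mulr1 !mulg1 !xrootN => h.
  by rewrite mul1g /commutator -(mulgA (xroot e a s)) h !mulgA mulgV mul1g mulgK.
have [c [w [hc hw W]]] := commutator_formula_le bP aP (nonprop_sym ab) ba.
pose w' := [seq letter x.1 (- (-1) ^+ x.2.1.2 * x.2.1.1) x.2.2 x.2.1.2 | x <- w].
exists c, (rev w'), [::]; split.
- by rewrite addrC.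
- rewrite cats0 all_rev all_map; apply: sub_all hw => x.
  rewrite /higher_letter /= => /and4P[/eqP-> -> -> n]; rewrite addrC eqxx /=.
  by move: n; rewrite !xpair_eqE andbC.
move=> R s t; have := W R (- t) s; rewrite -!GLval_gword => /(@GLval_inj _ _ _ _).
have wI : (gword (- t) s w)^-1%g = gword s t (rev w').
  rewrite /w'; elim: w {hw W w'} => [|x w IHw]; first by rewrite /= !gword_nil invg1.
  rewrite gword_cons invgM IHw /= rev_cons -cats1 gword_cat gword_cons gword_nil mulg1 /=.
  congr (_ * _)%g; rewrite -xrootN; congr xroot.
  rewrite (exprNn t) intrM intrN intr_sign; ring.
rewrite !gword_cat !gword_cons !gword_nil /= !expr0 !expr1 !mul1r !mulr1 !mulg1.
move=> h; rewrite -wI (addrC a) -[c%:~R * s * t]opprK xrootN.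
have {}h : (xroot e b t * xroot e a s * (xroot e b t)^-1 * (xroot e a s)^-1)%g =
    (xroot e (b + a) (- (c%:~R * s * t)) * gword (- t) s w)%g.
  rewrite -!mulgA -xrootN (mulgA (xroot e a s)) h mulrN mulNr mulrAC !mulgA mulgK.
  by rewrite -xrootD subrr xroot0 mul1g.
by rewrite -invgM -h /commutator !invgM !invgK !mulgA.
Qed.

End ChevalleyCommutator.

(** * Weyl group elements *)

Section WeylElements.
Context (F : realFieldType) (V : vectType F) (dot : {dot V for idfun}).
Context (Phi : root_system dot) (redPhi : reduced Phi) (m : nat).
Context (e : chevalley_rep Phi m.+1).
Local Notation rt := (rs_roots Phi).
Implicit Types (a b g d : V).

Definition weylmx (R : comPzRingType) g : 'M[R]_m.+1 :=
  expmx (e g) 1 * expmx (e (- g)) (-1) * expmx (e g) 1.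

Lemma weylmx_morph (R1 R2 : comPzRingType) (f : {rmorphism R1 -> R2}) g :
  map_mx f (weylmx R1 g) = weylmx R2 g.
Proof. by rewrite /weylmx !map_mxM !expmx_morph rmorph1 rmorphN1. Qed.

Lemma mulrz_mx_eq0 n (X : 'M[int]_n) (z : int) : X != 0 -> X *~ z = 0 -> z = 0.
Proof.
move=> X0 Xz; apply/eqP; apply: contraNT X0 => z0; apply/eqP/matrixP => i j.
have /matrixP/(_ i j) := Xz; rewrite -scaler_int !mxE intz => /eqP.
by rewrite mulf_eq0 (negPf z0) => /eqP.
Qed.

Lemma lie_coroot a b (z : int) : a \in rt -> b \in rt -> 2 * dot b a = z%:~R * dot a a ->
  lie (lie (e a) (e (- a))) (e b) = e b *~ z.
Proof. by move=> aP bP h; apply: chevalley_coroot => //; apply/(cartanE _ _ aP). Qed.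

(* The bracket hypotheses say that [y 0, ..., y q] is, up to signs, the standard
   basis of the weight [q] module of the SL_2 attached to the root [g]. *)
Lemma weyl_string g (y : nat -> 'M[int]_m.+1) q : (q <= 3)%N ->
  (forall i, (i < q)%N -> exists2 s : int, s = 1 \/ s = -1 &
     lie (e g) (y i) = y i.+1 *~ (s * i.+1%:Z)) ->
  lie (e g) (y q) = 0 -> lie (e (- g)) (y 0%N) = 0 ->
  (forall i, (i <= q)%N ->
     lie (lie (e g) (e (- g))) (y i) = y i *~ (2 * i%:Z - q%:Z)) ->
  forall i, (i <= q)%N -> exists2 s : int, s = 1 \/ s = -1 &
    weylmx int g * y i = y (q - i)%N *~ s * weylmx int g.
Proof.
move=> q3 hE hq h0 hH i iq.
have natK (k : nat) : k.+1%:R != 0 :> rat by rewrite pnatr_eq0.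
have mapE (X Y : 'M[int]_m.+1) :
    map_mx intr X * map_mx intr Y - map_mx intr Y * map_mx intr X =
    map_mx intr (lie X Y) :> 'M[rat]_m.+1.
  by rewrite /lie rmorphB !rmorphM.
have [||j jq||||s sE h] := @weyl_conj _ _ natK m.+1 (rvec e rat g) (rvec e rat (- g))
  (fun i => map_mx intr (y i)) q q3 _ _ _ _ _ _ i iq.
- by have := rvec_nilp e g (1 : rat); rewrite scale1r.
- by have := rvec_nilp e (- g) (1 : rat); rewrite scale1r.
- by have [s sE h] := hE j jq; exists s => //; rewrite mapE h raddfMz.
- by rewrite mapE hq raddf0.
- by rewrite mapE h0 raddf0.
- by move=> j jq; rewrite !mapE hH // raddfMz.
exists s => //; move: h.
rewrite -[rvec e rat g]scale1r -scaleN1r !nexp_rvec // -/(weylmx rat g).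
rewrite -(weylmx_morph intr) -raddfMz -!rmorphM /= => /matrixP h.
by apply/matrixP => k l; have := h k l; rewrite !mxE => /intr_inj.
Qed.

(** For d = g or -g the module is spanned by e_{-g}, h_g, e_g with q = 2; otherwise it is the
    g-string through d. In the string d sits at position p and is sent to position q - p, a shift by
    q - 2p = -z. *)
Lemma weyl_rootvec g d (z : int) : g \in rt -> d \in rt ->
  2 * dot d g = z%:~R * dot g g ->
  exists2 s : int, s = 1 \/ s = -1 &
    weylmx int g * e d = e (d - g *~ z) *~ s * weylmx int g.
Proof.
move=> gP dP zE; have g0 := lt0r_neq0 (dot_root_gt0 gP).
have lie_self X : lie X X = 0 :> 'M[int]_m.+1 by rewrite /lie subrr.
have [dg|] := boolP ((d == g) || (d == - g)).
  pose y i := nth 0 [:: e (- g); lie (e g) (e (- g)); e g] i.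
  have Hp : lie (lie (e g) (e (- g))) (e g) = e g *~ 2 by apply: lie_coroot.
  have Hn : lie (lie (e g) (e (- g))) (e (- g)) = e (- g) *~ (-2).
    by apply: lie_coroot; rewrite ?root_opp // dotNl mulrN mulNr.
  have key i : (i <= 2)%N -> exists2 s : int, s = 1 \/ s = -1 &
    weylmx int g * y i = y (2 - i)%N *~ s * weylmx int g.
    apply: weyl_string => // [[|[|//]] _|[|[|[|//]]] _].
    - by exists 1; [left | rewrite mulr1].
    - by exists (-1); [right | rewrite lieC Hp -mulrNz].
    - by rewrite /y /= Hn.
    - by rewrite /y /= lie_self mulr1 subrr mulr0z.
    - by rewrite /y /= Hp.
  case/orP: dg => /eqP dg; move: zE; rewrite dg.
  - move=> zE'; have -> : z = 2 by apply/(@intr_inj F)/(mulIf g0); rewrite -zE'.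
    have [s sE h] := key 2 isT; exists s => //; move: h; rewrite /y /=.
    by rewrite -[_ *~ 2]/(g *+ 2) mulr2n opprD addrA subrr sub0r.
  - rewrite dotNl mulrN -mulNr => zE'.
    have -> : z = -2 by apply/(@intr_inj F)/(mulIf g0); rewrite -zE'.
    have [s sE h] := key 0%N isT; exists s => //; move: h; rewrite /y /=.
    by rewrite mulrNz opprK -[_ *~ 2]/(g *+ 2) mulr2n addrA addNr add0r.
rewrite negb_or => gd.
have [p [q [pq q3 str dotE]]] := root_string redPhi gP dP gd.
have zE'  : z = 2 * p%:Z - q%:Z.
  by apply/(@intr_inj F)/(mulIf g0); rewrite -zE.
rewrite {}zE' {zE}.
pose r i := d + g *~ (i%:Z - p%:Z).
have rP i : (i <= q)%N -> r i \in rt by rewrite /r str; lia.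
have rgD i : g + r i = d + g *~ (i.+1%:Z - p%:Z).
  rewrite /r addrCA; congr (_ + _); rewrite -[X in X + _]mulr1z -mulrzDr; congr (_ *~ _); lia.
have gr i : nonprop g (r i).
  have := @lincomb_nonprop _ _ _ _ redPhi d g dP gP (nonprop_sym gd) 0 1 1 (i%:Z - p%:Z).
  by rewrite mulr0z add0r !mulr1z; apply; rewrite xpair_eqE.
have rB i (k : int) : r i - g *~ k = d + g *~ (i%:Z - p%:Z - k).
  by rewrite /r -addrA -mulrzBr.
have [i iq|||i iq|s sE] := @weyl_string g (fun i => e (r i)) q q3 _ _ _ _ p pq.
- have [||||s sE ->] := @lie_root _ _ _ _ redPhi _ e g (r i) i gP _ (gr i); last by exists s; rewrite ?rgD.
  + by apply: rP; apply: ltnW.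
  + by rewrite rgD rP.
  + by rewrite rB str; lia.
  + by rewrite rB str; lia.
- apply: lie_nonroot; last by rewrite rgD str; lia.
  by have /andP[_] := gr q; rewrite addrC addr_eq0.
- apply: lie_nonroot; last by rewrite addrC -[g]mulr1z rB str; lia.
  by have /andP[+ _] := gr 0%N; rewrite addrC subr_eq0.
- apply: lie_coroot; rewrite ?rP //.
  by rewrite /r dotDl dotMzl mulrDr dotE !rmorphB !rmorphM /=; ring.
rewrite /r subrr mulr0z addr0 => ->; exists s => //; congr (e (_ + _) *~ _ * _).
by rewrite -mulrNz; congr (_ *~ _); lia.
Qed.

End WeylElements.

Lemma lie_intertwine n (W X Y X' Y' : 'M[int]_n) : W * X = X' * W -> W * Y = Y' * W ->
  W * lie X Y = lie X' Y' * W.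
Proof. by move=> hX hY; rewrite /lie mulrBr mulrBl !mulrA hX hY -!mulrA hX hY. Qed.

(** * Action of Weyl group elements on opposite root subgroups *)

Section WeylElements.
Context (F : realFieldType) (V : vectType F) (dot : {dot V for idfun}).
Context (Phi : root_system dot) (redPhi : reduced Phi) (m : nat).
Context (e : chevalley_rep Phi m.+1).
Local Notation rt := (rs_roots Phi).
Implicit Types (a b g d : V).

Definition weylg (R : comPzRingType) g : GL R m.+1 :=
  (xroot e g (1%R : R) * xroot e (- g)%R (-1)%R * xroot e g 1%R)%g.

Lemma weylmx_regl (R : comPzRingType) g (X Y : 'M[R]_m.+1) :
  X * weylmx e R g = Y * weylmx e R g -> X = Y.
Proof.
have wV : weylmx e R g * (GL_pair (weylg R g)).2 = 1 := GL_valV (weylg R g).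
by move=> h; rewrite -[X]mulr1 -[Y]mulr1 -wV (mulrA X (weylmx e R g)) h mulrA.
Qed.

(** Conjugating [[e_d, e_{-d}], e_d] = 2 e_d gives s s' s = s for the signs s, s' at d and -d,
    because e at the reflected root is nonzero; hence s' = s. *)
Lemma weyl_rootvec_opp g d (z : int) : g \in rt -> d \in rt ->
  2 * dot d g = z%:~R * dot g g ->
  exists2 s : int, s = 1 \/ s = -1 & let d' := d - g *~ z in
    weylmx e int g * e d = e d' *~ s * weylmx e int g /\
    weylmx e int g * e (- d) = e (- d') *~ s * weylmx e int g.
Proof.
move=> gP dP zE; have d'P := root_refl gP dP zE.
have [s sE h] := weyl_rootvec redPhi e gP dP zE.
have [s' sE' h'] : exists2 s : int, s = 1 \/ s = -1 &
    weylmx e int g * e (- d) = e (- (d - g *~ z)) *~ s * weylmx e int g.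
  rewrite opprB addrC -[g *~ z]opprK -mulrNz; apply: weyl_rootvec => //.
    by rewrite root_opp.
  by rewrite dotNl mulrN zE intrN mulNr.
set d' := d - g *~ z in d'P h h' *.
have lieZ (X Y : 'M[int]_m.+1) k l : lie (X *~ k) (Y *~ l) = lie X Y *~ (k * l).
  by rewrite /lie !mulrzAl !mulrzAr -!mulrzA mulrzBl [k * l]mulrC.
have := lie_intertwine (lie_intertwine h h') h.
rewrite lieZ lieZ !(lie_coroot _ (z := 2)) // mulrzAr h -mulrzAl => /weylmx_regl.
rewrite -!mulrzA => /eqP; rewrite -subr_eq0 -mulrzBr => /eqP ss.
have {}ss := mulrz_mx_eq0 (chevalley_faithful e d'P) ss.
exists s => //=; split=> //; rewrite h'; congr (_ *~ _ * _).
by case: sE ss => ->; case: sE' => ->.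
Qed.

(** Integer matrices have no torsion, so the intertwining relation passes from the powers of e_d to
    its divided powers, and from there to R. *)
Lemma weyl_xroot (R : comNzRingType) g d d' (s : int) : s = 1 \/ s = -1 ->
  weylmx e int g * e d = e d' *~ s * weylmx e int g ->
  forall r : R, (weylg R g * xroot e d r)%g = (xroot e d' (s%:~R * r)%R * weylg R g)%g.
Proof.
move=> sE h r; apply: GLval_inj.
change (weylmx e R g * expmx (e d) r = expmx (e d') (s%:~R * r) * weylmx e R g).
have hk k : weylmx e int g * e d ^+ k = (e d' *~ s) ^+ k * weylmx e int g.
  elim: k => [|k IHk]; first by rewrite !expr0 mulr1 mul1r.
  by rewrite exprS mulrA h -mulrA IHk mulrA -exprS.
have hd k : weylmx e int g * divpow (e d) k = divpow (e d') k *~ s ^+ k * weylmx e int g.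
  apply: (mulrn_mx_inj (fact_gt0 k)).
  rewrite -mulrnAr divpowK hk -mulrnAl pmulrn mulrzAC -pmulrn divpowK.
  by rewrite -!scaler_int exprZn !intz.
rewrite /expmx mulr_sumr mulr_suml; apply: eq_bigr => k _.
rewrite -[LHS]scalerAr -[RHS]scalerAl -(weylmx_morph e intr) -!rmorphM hd /= mulrzAl raddfMz /=.
rewrite -scaler_int scalerA exprMn mulrC; congr (_ *: _); congr (_ * _).
by rewrite -!(rmorphXn (intmul 1)).
Qed.

End WeylElements.

(** * Elementary commutators modulo E(Phi, R, AB) *)

Section Quotient.
Context (G : groupType) (E N : set G).
Hypotheses (subE : is_subgroup E) (subN : is_subgroup N).
Hypothesis nN : forall g h, E g -> N h -> N (g * h * g^-1)%g.
Local Open Scope group_scope.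

(** A chosen representative in E of the coset of g modulo N. The quotient is carried by the elements
    of E fixed by [rep]; the default 1 does not arise for g in E, since g itself is a candidate. *)
Let rep (g : G) : G := xget 1 [set h | E h /\ N (g^-1 * h)]%classic.

Let repP g : E g -> E (rep g) /\ N (g^-1 * rep g).
Proof.
move=> Eg; apply: (@xgetPex _ 1 [set h | E h /\ N (g^-1 * h)]%classic).
by exists g; split=> //; rewrite mulVg; case: subN.
Qed.

Let rep_eq g h : N (g^-1 * h) -> rep g = rep h.
Proof.
move=> gh; congr xget; apply/seteqP; split=> x /= -[Ex Nx]; split=> //.
  have -> : h^-1 * x = (g^-1 * h)^-1 * (g^-1 * x) by rewrite invgM invgK -mulgA mulVKg.
  by case: subN => _ NM NV; apply: NM => //; apply: NV.
have -> : g^-1 * x = g^-1 * h * (h^-1 * x) by rewrite -mulgA mulVKg.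
by case: subN => _ NM _; apply: NM.
Qed.

Let qpred (g : G) : bool := `[< E g /\ rep g = g >].
Local Notation Q := {g : G | qpred g}.

Let rep_rep g : E g -> rep (rep g) = rep g.
Proof. by move=> Eg; have [_ h] := repP Eg; rewrite -(rep_eq h). Qed.

Let repQ g : E g -> qpred (rep g).
Proof. by move=> Eg; apply/asboolP; split; [case: (repP Eg) | apply: rep_rep]. Qed.

Let EQ (x : Q) : E (val x). Proof. by have /asboolP[] := valP x. Qed.
Let EM x y : E x -> E y -> E (x * y). Proof. by case: subE => _ + _; apply. Qed.
Let EV x : E x -> E x^-1. Proof. by case: subE => _ _; apply. Qed.
Let E1 : E 1. Proof. by case: subE. Qed.

Let Qmul (x y : Q) : Q := exist (fun g => qpred g) _ (repQ (EM (EQ x) (EQ y))).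
Let Qinv (x : Q) : Q := exist (fun g => qpred g) _ (repQ (EV (EQ x))).
Let Qone : Q := exist (fun g => qpred g) _ (repQ E1).

Let rep_mull g h : E g -> E h -> rep (rep g * h) = rep (g * h).
Proof.
move=> Eg Eh; have [_ Ng] := repP Eg; symmetry; apply: rep_eq.
rewrite invgM -!mulgA (mulgA g^-1).
by have := nN (EV Eh) Ng; rewrite invgK !mulgA.
Qed.

Let rep_mulr g h : E g -> E h -> rep (g * rep h) = rep (g * h).
Proof.
move=> Eg Eh; have [_ Nh] := repP Eh; symmetry; apply: rep_eq.
by rewrite invgM -!mulgA mulKg.
Qed.

Let Qval_rep (x : Q) : rep (val x) = val x.
Proof. by have /asboolP[] := valP x. Qed.

Let QmulA : associative Qmul.
Proof.
move=> x y z; apply: val_inj => /=.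
by rewrite (rep_mulr (EQ x) (EM (EQ y) (EQ z))) (rep_mull (EM (EQ x) (EQ y)) (EQ z)) mulgA.
Qed.

Let Qmul1g : left_id Qone Qmul.
Proof. by move=> x; apply: val_inj; rewrite /= (rep_mull E1 (EQ x)) mul1g Qval_rep. Qed.
Let Qmulg1 : right_id Qone Qmul.
Proof. by move=> x; apply: val_inj; rewrite /= (rep_mulr (EQ x) E1) mulg1 Qval_rep. Qed.
Let QmulVg : left_inverse Qone Qinv Qmul.
Proof. by move=> x; apply: val_inj; rewrite /= (rep_mull (EV (EQ x)) (EQ x)) mulVg. Qed.
Let QmulgV : right_inverse Qone Qinv Qmul.
Proof. by move=> x; apply: val_inj; rewrite /= (rep_mulr (EQ x) (EV (EQ x))) mulgV. Qed.

(** This turns congruences modulo N into equalities in a group, so that they can be rewritten. Only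
    the values of p on E are controlled. *)
Lemma quotient_group : exists (T : groupType) (p : G -> T),
  (forall g h, E g -> E h -> p (g * h) = p g * p h) /\
  (forall g h, E g -> E h -> p g = p h <-> N (g^-1 * h)).
Proof.
pose T : groupType := HB.pack Q (isGroup.Build Q QmulA Qmul1g Qmulg1 QmulVg QmulgV).
have pE g : E g -> val (insubd Qone (rep g) : Q) = rep g.
  by move=> Eg; rewrite insubdK // unfold_in; apply: repQ.
exists T, (fun g => insubd Qone (rep g) : Q); split=> g h Eg Eh.
  apply: val_inj; rewrite pE; last exact: EM.
  change (rep (g * h) = rep (val (insubd Qone (rep g) : Q) * val (insubd Qone (rep h) : Q))).
  by rewrite !pE // rep_mull ?rep_mulr //; case: (repP Eh).
split=> [/(congr1 val)|/rep_eq gh]; last by congr insubd.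
rewrite !pE // => gh; have [_ Ng] := repP Eg; have [_ Nh] := repP Eh.
rewrite gh in Ng; have [_ NM NV] := subN.
have := NM _ _ Ng (NV _ Nh).
by rewrite invgM invgK -mulgA mulVKg.
Qed.

End Quotient.

(** * Commutator calculus in a group *)

Section GroupCommutators.
Context (Q : groupType).
Implicit Types (x y z u v : Q).
Local Open Scope group_scope.

Lemma commutator_commute x y : commute x y -> commutator x y = 1.
Proof. by move=> xy; rewrite /commutator xy mulgK mulgV. Qed.

Lemma commutator1_commute x y : commutator x y = 1 -> commute x y.
Proof. by rewrite /commutator => /divg1_eq/(congr1 (fun z => z * x)); rewrite mulgVK. Qed.

Lemma commutator_conj x y z :
  z * commutator x y * z^-1 = commutator (z * x * z^-1) (z * y * z^-1).
Proof. by rewrite /commutator !invgM !invgK !mulgA !mulgVK. Qed.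

Lemma conj_commutator x z : z * x * z^-1 = x * commutator x^-1 z.
Proof. by rewrite /commutator invgK !mulgA mulgV mul1g. Qed.

Lemma commutator_mul_commute x y u v :
  commute u y -> commute u v -> commute v x ->
  commutator (x * u) (y * v) = commutator x y.
Proof.
move=> uy uv vx; rewrite /commutator !invgM -!mulgA; congr (x * _).
rewrite (mulgA u) uy -!mulgA (mulgA u) uv; congr (y * _).
by rewrite -!mulgA mulVKg (mulgA v) (commuteV vx) -!mulgA mulVKg.
Qed.

Lemma commutatorVV x y : commute x (commutator x y) -> commute y (commutator x y) ->
  commutator x^-1 y^-1 = commutator x y.
Proof.
move=> cx cy; rewrite {1}/commutator !invgK -mulgA -invgM.
have -> : x * y = y * x * commutator x y.
  have <- : commute (commutator x y) (y * x) by apply: commuteM; apply: commute_sym.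
  by rewrite /commutator -!mulgA mulKg mulVg mulg1.
by rewrite mulKg.
Qed.

Lemma commutator_expr x y n : commute y (commutator x y) ->
  commutator x (y ^+ n) = commutator x y ^+ n.
Proof.
move=> cy; elim: n => [|n IHn]; first by rewrite !expg0 /commutator invg1 !mulg1 mulgV.
rewrite !expgS -IHn {1}/commutator invgM.
have h : x * y * x^-1 = commutator x y * y by rewrite mulgVK.
have -> : x * (y * y ^+ n) * x^-1 = x * y * x^-1 * (x * y ^+ n * x^-1).
  by rewrite !mulgA mulgVK.
have h' : x * y ^+ n * x^-1 = commutator x (y ^+ n) * y ^+ n by rewrite mulgVK.
rewrite h h'.
have yc : commute y (commutator x (y ^+ n)) by rewrite IHn; apply: commuteX.
transitivity (commutator x y * (y * commutator x (y ^+ n)) * y^-1).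
  by rewrite !mulgA mulgK.
by rewrite yc !mulgA mulgK.
Qed.

Lemma commutatorV x y : commutator y x = (commutator x y)^-1.
Proof. by rewrite /commutator !invgM !invgK !mulgA. Qed.

Lemma commutator_mulr x u v :
  commutator x (u * v) = commutator x u * (u * commutator x v * u^-1).
Proof. by rewrite /commutator !invgM !mulgA !mulgVK. Qed.

Lemma commutator_mul_commutel x u v : commute x u ->
  commutator x (u * v) = u * commutator x v * u^-1.
Proof. by move=> xu; rewrite commutator_mulr commutator_commute // mul1g. Qed.

Lemma commutator_mul_commuter x u v : commute x v -> commutator x (u * v) = commutator x u.
Proof.
by move=> xv; rewrite commutator_mulr (commutator_commute xv) mulg1 mulgV mulg1.
Qed.

Lemma commutatorVr x y : commute y (commutator x y) ->
  commutator x y^-1 = (commutator x y)^-1.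
Proof.
move/commuteV => h.
have -> : (commutator x y)^-1 = y^-1 * (commutator x y)^-1 * y by rewrite -mulgA -h mulKg.
by rewrite -commutatorV /commutator invgK !mulgA mulVg mul1g.
Qed.

End GroupCommutators.

Lemma productP (R : comPzRingType) (A B : set R) a b : A a -> B b ->
  product_ideal A B (a * b).
Proof. by move=> Aa Bb I [_ sub]; apply: sub; exists a, b. Qed.

Lemma product_is_ideal (R : comPzRingType) (A B : set R) : is_ideal (product_ideal A B).
Proof.
split=> [I [[]] //|x y Ix Iy I IP|r x Ix I IP].
  by have [[_ ID _] _] := IP; apply: ID; [apply: Ix | apply: Iy].
by have [[_ _ IM] _] := IP; apply: IM; apply: Ix.
Qed.

(** * Orbits of roots under reflections *)

Section EqualLengthRoots.
Context (F : realFieldType) (V : vectType F) (dot : {dot V for idfun}).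
Context (Phi : root_system dot).
Hypotheses (redPhi : reduced Phi) (irrPhi : irreducible Phi).
Local Notation rt := (rs_roots Phi).
Implicit Types a b c d g x : V.

Lemma dot_refl g d (z : int) : g \in rt -> 2 * dot d g = z%:~R * dot g g ->
  dot (d - g *~ z) (d - g *~ z) = dot d d.
Proof.
move=> gP zE; rewrite dotDl !dotDr !dotNl !dotNr !dotMzl !dotMzr (dotC _ g d).
have -> : dot d g = z%:~R * dot g g / 2 by rewrite -zE; field.
by field.
Qed.

(** Let P c say that some root in the class S, of the length of a, is not orthogonal to c. If P
    failed at b, irreducibility would give non-orthogonal d and d' with P d and not P d'; reflecting
    in d a witness for d produces a witness for d'. *)
Lemma orbit_nonorth (S : V -> Prop) a b :
  (forall g x (z : int), g \in rt -> x \in rt -> 2 * dot x g = z%:~R * dot g g ->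
     S x -> S (x - g *~ z)) ->
  a \in rt -> b \in rt -> S a ->
  exists x, [/\ x \in rt, dot x x = dot a a, S x & dot x b != 0].
Proof.
move=> Srefl aP bP Sa.
pose T x := [/\ x \in rt, dot x x = dot a a & S x].
pose P c := exists x, T x /\ dot x c != 0.
have Pa : P a by exists a; split; rewrite ?lt0r_neq0 ?(dot_root_gt0 aP).
suff [x [[xP xa Sx] xb]] : P b by exists x.
have [//|nPb] := pselect (P b).
have [||d [d' [dP d'P [x [[xP xa Sx] xd]] nPd' dd']]] := @irrPhi P; [by exists a | by exists b |].
have [z zE] := cartan_int dP xP; exfalso; apply: (nPd').
have d0 := dot_root_gt0 dP.
have z0 : z != 0.
  apply: contraNneq xd => z0; move: zE; rewrite z0 mul0r => /eqP.
  by rewrite mulf_eq0 pnatr_eq0.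
have xd' : dot x d' = 0.
  by apply/eqP; apply: contra_notT nPd' => xd'; exists x.
exists (x - d *~ z); split; first by split; [exact: root_refl | rewrite dot_refl | exact: Srefl].
by rewrite dotDl dotNl dotMzl xd' sub0r oppr_eq0 mulf_neq0 ?intr_eq0.
Qed.

(** A root x of S with the length of b and not orthogonal to b has Cartan integer 1 or -1 with it.
    Reflecting x in b and the result in x gives -b or b, and S is stable under sign change. *)
Lemma orbit_equal_length (S : V -> Prop) a b :
  (forall g x (z : int), g \in rt -> x \in rt -> 2 * dot x g = z%:~R * dot g g ->
     S x -> S (x - g *~ z)) ->
  a \in rt -> b \in rt -> dot a a = dot b b -> S a -> S b.
Proof.
move=> Srefl aP bP ab Sa.
have [x [xP xa Sx xb]] := orbit_nonorth Srefl aP bP Sa.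
have b0 := dot_root_gt0 bP.
have flip c : c \in rt -> S c -> S (- c).
  move=> cP /(Srefl c c 2 cP cP (erefl _)).
  by rewrite -[_ *~ 2]/(c *+ 2) mulr2n opprD addrA subrr sub0r.
have [<-//|xnb] := eqVneq x b.
have [xNb|xnNb] := eqVneq x (- b); first by rewrite -[b]opprK -xNb; apply: flip.
have np : nonprop b x by rewrite /nonprop xnb xnNb.
have [z zE] := cartan_int bP xP; have [n nE] := cartan_int xP bP.
have [h1 h2 h3] := cartan_prod redPhi bP xP np zE nE.
have zn : z = n.
  apply/(@intr_inj F)/(mulIf (lt0r_neq0 b0)).
  by rewrite -zE dotC nE xa ab.
have z0 : z != 0.
  apply: contraNneq xb => z0; move: zE; rewrite z0 mul0r => /eqP.
  by rewrite mulf_eq0 pnatr_eq0.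
have Sx' := Srefl b x z bP xP zE Sx.
have x'P := root_refl bP xP zE.
have [z1|z1] : z = 1 \/ z = -1 by nia.
- have e : 2 * dot (x - b *~ z) x = 1%:~R * dot x x.
    rewrite dotDl dotNl dotMzl z1 mulrBr mul1r nE -zn z1; ring.
  have := Srefl _ _ _ xP x'P e Sx'; rewrite z1 !mulr1z (addrAC x) subrr sub0r.
  by move/(flip _ _); rewrite opprK root_opp; apply.
- have e : 2 * dot (x - b *~ z) x = 1%:~R * dot x x.
    rewrite dotDl dotNl dotMzl z1 mulrBr mulN1r mulrN nE -zn z1; ring.
  have := Srefl _ _ _ xP x'P e Sx'.
  by rewrite z1 mulrNz opprK !mulr1z (addrAC x) subrr add0r.
Qed.

End EqualLengthRoots.

Lemma lie_jacobi n (X Y Z : 'M[int]_n) :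
  lie (lie X Y) Z = lie X (lie Y Z) - lie Y (lie X Z).
Proof. by rewrite /lie (br_jacobi X Y Z) addrK. Qed.

Lemma lieMzr n (X Y : 'M[int]_n) k : lie X (Y *~ k) = lie X Y *~ k.
Proof. by rewrite /lie mulrzAr mulrzAl mulrzBl. Qed.

Lemma lieMzl n (X Y : 'M[int]_n) k : lie (X *~ k) Y = lie X Y *~ k.
Proof. by rewrite lieC lieMzr lieC mulNrz opprK. Qed.

Lemma lieBl n (X Y Z : 'M[int]_n) : lie (X - Y) Z = lie X Z - lie Y Z.
Proof. by rewrite /lie mulrBl mulrBr !opprB [LHS]addrACA [RHS]addrACA (addrC (- (Y * Z))). Qed.

Section IntegerCombinations.
Context (F : realFieldType) (V : vectType F) (dot : {dot V for idfun}).
Context (Phi : root_system dot) (redPhi : reduced Phi).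
Local Notation rt := (rs_roots Phi).
Variables a b : V.

Lemma intcombN (i j : int) : - (a *~ i + b *~ j) = a *~ (- i) + b *~ (- j).
Proof. by rewrite opprD !mulrNz. Qed.
Lemma intcomb10 : a = a *~ 1 + b *~ 0. Proof. by rewrite mulr1z mulr0z addr0. Qed.
Lemma intcomb_nat (i j : nat) : a *+ i + b *+ j = a *~ i%:Z + b *~ j%:Z.
Proof. by []. Qed.
Lemma intcombN_nat (i j : nat) : (- a) *+ i + b *+ j = a *~ (- i%:Z) + b *~ j%:Z.
Proof. by rewrite mulNrn mulrNz. Qed.
Lemma intcomb_neq0 (i j : int) : a \in rt -> b \in rt -> nonprop a b ->
  (i, j) != (0, 0) -> a *~ i + b *~ j != 0.
Proof.
move=> aP bP ab; apply: contraNneq => /(lincomb_eq0 redPhi aP bP ab).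
by rewrite xpair_eqE.
Qed.
End IntegerCombinations.

(** * Structure constants for a long root d, a short root g and their sum *)

Section StructureConstants.
Context (F : realFieldType) (V : vectType F) (dot : {dot V for idfun}).
Context (Phi : root_system dot) (m : nat) (e : chevalley_rep Phi m.+1).
Hypothesis redPhi : reduced Phi.
Local Notation rt := (rs_roots Phi).
Variables (d g : V) (q : int).
Hypotheses (dP : d \in rt) (gP : g \in rt) (dg : nonprop d g).
Hypotheses (q23 : q = 2 \/ q = 3) (gr : gram dot d g q (-1)).

Lemma sum_root : d + g \in rt.
Proof.
have h : 2 * dot g d = (-1)%:~R * dot d d.
  by case: gr => h1 h2; rewrite dotC h2 h1 intrM; ring.
by have := root_refl dP gP h; rewrite mulrNz mulr1z opprK (addrC g).
Qed.

Lemma sum_dot : dot (d + g) (d + g) = dot g g.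
Proof.
case: gr => h1 h2; rewrite dotDl !dotDr (dotC dot g d) h1.
have -> : dot d g = (q * -1)%:~R * dot g g / 2 by rewrite -h2; field.
by rewrite intrM; field.
Qed.

Lemma sum_sign : exists2 c : int, c = 1 \/ c = -1 & lie (e d) (e g) = e (d + g) *~ c.
Proof.
have nP : g - d \notin rt.
  have nr i j := gram_nonroot dP gP (i := i) (j := j) gr.
  have : d *~ (-1) + g *~ 1 \notin rt by apply: nr; case: q23 => ->.
  by rewrite mulrNz !mulr1z addrC.
have [s sE h] := @lie_root _ _ _ _ redPhi _ e d g 0 dP gP dg sum_root
  (eq_ind_r (fun c => c \in rt) gP (subr0 g)) nP.
by exists s => //; rewrite h mulr1.
Qed.

(** With z = d + g the Jacobi identity reads c h_z = c' h_d - c3 h_g. Its weights on e_d and e_g are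
    two linear equations in c' and c3, which determine c' because q is not 4. *)
Lemma sum_constants (c c' : int) : lie (e d) (e g) = e (d + g) *~ c ->
  lie (e g) (e (- (d + g))) = e (g - (d + g)) *~ c' -> c' = c * q.
Proof.
have -> : g - (d + g) = - d by rewrite opprD addrCA subrr addr0.
move=> hc hc'.
have zP := sum_root; have NzP : - (d + g) \in rt by rewrite root_opp.
have [c3 hc3] : exists c3, lie (e d) (e (- (d + g))) = e (- g) *~ c3.
  have -> : - g = d - (d + g) by rewrite opprD addrA subrr add0r.
  apply: lie_root_ex => //; last by rewrite opprD addrA subrr add0r root_opp.
  have := lincomb_nonprop redPhi dP gP dg (i := 1) (j := 0) (k := -1) (l := -1) isT isT.
  by rewrite mulr1z mulr0z addr0 !mulrNz !mulr1z -opprD.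
have J : lie (lie (e d) (e g)) (e (- (d + g))) =
    lie (e d) (e (- d)) *~ c' - lie (e g) (e (- g)) *~ c3.
  by rewrite lie_jacobi hc' hc3 !lieMzr.
rewrite hc lieMzl in J.
have eqc b z1 z2 z3 : b \in rt -> 2 * dot b (d + g) = z1%:~R * dot g g ->
    2 * dot b d = z2%:~R * dot d d -> 2 * dot b g = z3%:~R * dot g g ->
    z1 * c = z2 * c' - z3 * c3.
  move=> bP h1 h2 h3; rewrite -sum_dot in h1.
  have := congr1 (fun Y => lie Y (e b)) J.
  rewrite lieBl !lieMzl (lie_coroot e zP bP h1) (lie_coroot e dP bP h2) (lie_coroot e gP bP h3).
  rewrite -!mulrzA -mulrzBr => /eqP; rewrite -subr_eq0 -mulrzBr => /eqP h.
  by apply/eqP; rewrite -subr_eq0; apply/eqP/(mulrz_mx_eq0 (chevalley_faithful e bP) h).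
case: gr => g1 g2.
have e1 : q * c = 2 * c' - (- q) * c3.
  apply: (eqc d) => //.
  - by rewrite dotDr mulrDr g1 g2 intrM; ring.
  - by rewrite g2 intrM; ring.
have e2 : (2 - q) * c = (- 1) * c' - 2 * c3.
  apply: (eqc g) => //.
  - by rewrite dotDr mulrDr (dotC dot g d) g2 intrM !intrD; ring.
  - by rewrite (dotC dot g d) g2 g1 intrM; ring.
by case: q23 e1 e2 => ->; lia.
Qed.

End StructureConstants.

(** * Relations between elementary commutators in an abstract quotient *)

Section ElementaryCommutators.
Context (F : realFieldType) (V : vectType F) (dot : {dot V for idfun}).
Context (Phi : root_system dot) (m : nat) (e : chevalley_rep Phi m.+1).
Hypotheses (redPhi : reduced Phi) (irrPhi : irreducible Phi) (rank2 : (2 <= rs_rank Phi)%N).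
Local Notation rt := (rs_roots Phi).
Context (R : comNzRingType) (A B : set R) (idA : is_ideal A) (idB : is_ideal B).
Context (Q : groupType) (X : V -> R -> Q).
Implicit Types (a b c d g : V) (r s t : R) (x y z u v : Q).

Definition wordX s t (w : seq (V * (int * nat * nat))) : Q :=
  (\prod_(x <- w) X x.1 (x.2.1.1%:~R * s ^+ x.2.1.2 * t ^+ x.2.2)%R)%g.

Definition weylX g : Q := (X g 1%R * X (- g)%R (-1)%R * X g 1%R)%g.

(** X a r is to be the class of the root element x_a(r) modulo N. In [X_weyl] the sign k is common
    to d and -d. *)
Hypotheses
  (XD : forall a r s, X a (r + s) = (X a r * X a s)%g)
  (X_out : forall a r, a \notin rt -> X a r = 1%g)
  (X_AB : forall a r, product_ideal A B r -> X a r = 1%g)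
  (X_comm : forall a b, a \in rt -> b \in rt -> nonprop a b ->
     exists (c : int) (w1 w2 : seq (V * (int * nat * nat))),
     [/\ lie (e a) (e b) = e (a + b) *~ c, all (higher_letter a b) (w1 ++ w2) &
       forall s t, commutator (X a s) (X b t) =
         (wordX s t w1 * X (a + b) (c%:~R * s * t)%R * wordX s t w2)%g])
  (X_weyl : forall g d (z : int), g \in rt -> d \in rt -> 2 * dot d g = z%:~R * dot g g ->
     exists2 k : int, k = 1 \/ k = -1 & let d' := d - g *~ z in
     forall r, (weylX g * X d r = X d' (k%:~R * r)%R * weylX g)%g /\
               (weylX g * X (- d)%R r = X (- d')%R (k%:~R * r)%R * weylX g)%g).

Lemma X0 a : X a 0 = 1%g.
Proof. by apply: (mulgI (X a 0)); rewrite -XD addr0 mulg1. Qed.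

Lemma XN a r : X a (- r) = ((X a r)^-1)%g.
Proof. by apply: (mulgI (X a r)); rewrite mulgV -XD subrr X0. Qed.

Lemma XMn a r n : X a (n%:R * r) = (X a r ^+ n)%g.
Proof.
elim: n => [|n IHn]; first by rewrite mul0r X0 expg0.
by rewrite expgS -IHn -XD mulrS mulrDl mul1r.
Qed.

Lemma ideal_scale (I : set R) (k : int) r s i j : is_ideal I -> I r -> (0 < i)%N ->
  I (k%:~R * r ^+ i * s ^+ j).
Proof.
case=> _ _ IM Ir; case: i => // i _.
by rewrite exprSr mulrA mulrAC; apply: IM.
Qed.

Lemma higher_letterP a b (k : V * (int * nat * nat)) : higher_letter a b k ->
  exists i j : nat, [/\ k.1 = a *+ i + b *+ j, k.2.1.2 = i, k.2.2 = j,
    (0 < i)%N /\ (0 < j)%N & (i, j) != (1, 1)%N].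
Proof. by case/and4P => /eqP h1 h2 h3 h4; exists k.2.1.2, k.2.2. Qed.

Lemma word_letter a b (c : int) w1 w2 k : all (higher_letter a b) (w1 ++ w2) ->
  k \in w1 ++ letter (a + b) c 1 1 :: w2 ->
  exists i j : nat, [/\ k.1 = a *+ i + b *+ j, k.2.1.2 = i, k.2.2 = j &
    (0 < i)%N /\ (0 < j)%N].
Proof.
move=> /allP h; rewrite mem_cat inE orbCA => /orP[/eqP->|]; last first.
  by rewrite -mem_cat => /h/higher_letterP[i [j [h1 h2 h3 h4 _]]]; exists i, j.
by exists 1%N, 1%N.
Qed.

Lemma wordX_split s t a (c : int) w1 w2 :
  (wordX s t w1 * X a (c%:~R * s * t)%R * wordX s t w2)%g =
  wordX s t (w1 ++ letter a c 1 1 :: w2).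
Proof. by rewrite /wordX big_cat big_cons /= !expr1 mulgA. Qed.

Lemma commute_wordX x s t w :
  (forall k, k \in w -> commute x (X k.1 (k.2.1.1%:~R * s ^+ k.2.1.2 * t ^+ k.2.2))) ->
  commute x (wordX s t w).
Proof.
rewrite /wordX; elim: w => [|k w IHw] h; first by rewrite big_nil; apply: commute1.
rewrite big_cons; apply: commuteM; first exact/h/mem_head.
by apply: IHw => k' kw; apply: h; rewrite inE kw orbT.
Qed.

Lemma X_commute a b r s : a + b != 0 -> A r -> B s -> commute (X a r) (X b s).
Proof.
move=> ab Ar Bs.
have [aP|aP] := boolP (a \in rt); last by rewrite X_out //; apply/commute_sym/commute1.
have [bP|bP] := boolP (b \in rt); last by rewrite [X b s]X_out //; apply: commute1.
have [->|nab] := eqVneq b a; first by rewrite /commute -!XD addrC.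
have np : nonprop a b by rewrite /nonprop nab -addr_eq0 addrC.
apply: commutator1_commute.
have [c [w1 [w2 [_ hw ->]]]] := X_comm aP bP np.
rewrite wordX_split /wordX big_seq big1 // => k /(word_letter hw)[i [j [_ -> -> [i0 j0]]]].
apply: X_AB; case: i i0 => // i _; case: j j0 => // j _.
rewrite (_ : _ * _ = k.2.1.1%:~R * r ^+ i * s ^+ j * (r * s)); last by rewrite !exprS; ring.
by have [_ _ IM] := product_is_ideal A B; exact: IM (productP Ar Bs).
Qed.

Definition yX a r s : Q := commutator (X a r) (X (- a)%R s).

Section Central.
Variables (r s : R) (Ar : A r) (Bs : B s).

Let AN r' : A r' -> A (- r').
Proof. by case: idA => _ _ IM; rewrite -mulN1r; apply: IM. Qed.
Let BN r' : B r' -> B (- r').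
Proof. by case: idB => _ _ IM; rewrite -mulN1r; apply: IM. Qed.

(** Conjugation by x_b(t) multiplies x_a(r) by a word u at roots i a + j b with parameters in A, and
    x_{-a}(s) by a word v at roots -i a + j b with parameters in B, always with j > 0. By the
    positive coefficients of b no two of the relevant roots are opposite, so u and v drop out of the
    commutator. *)
Lemma yX_commute_nonprop a b t : a \in rt -> b \in rt -> nonprop a b ->
  commute (yX a r s) (X b t).
Proof.
move=> aP bP ab.
have NaP : - a \in rt by rewrite root_opp.
have Nab : nonprop (- a) b.
  by rewrite /nonprop opprK andbC; move: ab; rewrite /nonprop.
have [c [w1 [w2 [_ hw hc]]]] := X_comm aP bP ab.
have [c' [w1' [w2' [_ hw' hc']]]] := X_comm NaP bP Nab.
set z := X b t.
have [u uE] : exists u, u = commutator (X a r)^-1%g z by exists (commutator (X a r)^-1%g z).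
have [v vE] : exists v, v = commutator (X (- a) s)^-1%g z by exists (commutator (X (- a) s)^-1%g z).
have conj : (z * yX a r s * z^-1)%g = yX a r s.
  rewrite /yX commutator_conj !conj_commutator -uE -vE.
  rewrite -XN hc wordX_split in uE; rewrite -XN hc' wordX_split in vE.
  apply: commutator_mul_commute.
  - apply/commute_sym; rewrite uE; apply: commute_wordX => k.
    move=> /(word_letter hw)[i [j [-> -> -> [i0 j0]]]].
    apply/commute_sym; apply: X_commute.
    + rewrite intcomb_nat {2}(intcomb10 a b) intcombN lincombD.
      by apply: (intcomb_neq0 redPhi) => //; rewrite xpair_eqE; lia.
    + by apply: ideal_scale => //; apply: AN.
    + by [].
  - rewrite vE; apply: commute_wordX => k.
    move=> /(word_letter hw')[i [j [-> -> -> [i0 j0]]]].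
    apply/commute_sym; rewrite uE; apply: commute_wordX => k'.
    move=> /(word_letter hw)[i' [j' [-> -> -> [i0' j0']]]].
    apply/commute_sym; apply: X_commute.
    + rewrite intcombN_nat intcomb_nat lincombD.
      by apply: (intcomb_neq0 redPhi) => //; rewrite xpair_eqE; lia.
    + by apply: ideal_scale => //; apply: AN.
    + by apply: ideal_scale => //; apply: BN.
  - apply/commute_sym; rewrite vE; apply: commute_wordX => k.
    move=> /(word_letter hw')[i [j [-> -> -> [i0 j0]]]].
    apply: X_commute.
    + rewrite intcombN_nat {1}(intcomb10 a b) lincombD.
      by apply: (intcomb_neq0 redPhi) => //; rewrite xpair_eqE; lia.
    + by [].
    + by apply: ideal_scale => //; apply: BN.
by rewrite /commute -{1}conj mulgVK.
Qed.

(** Irreducibility is applied to the set consisting of a and -a; if it contained all roots, they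
    would span a line, against rank at least 2. *)
Lemma exists_nonorth a : a \in rt -> exists g, [/\ g \in rt, nonprop a g & dot a g != 0].
Proof.
move=> aP; have [||g [h [gP hP ga ha gh]]] := @irrPhi (fun c => c = a \/ c = - a).
- by exists a => //; left.
-
  apply: contrapT => none; have : (\dim {: V} <= 1)%N.
    rewrite -(roots_span Phi) (@leq_trans (\dim <[a]>)) ?dim_vline ?leq_b1 //.
    rewrite -dim_vline dimvS //; apply/span_subvP => x xP.
    have [->|->] : x = a \/ x = - a.
      by apply: contrapT => nx; apply: none; exists x.
    - exact: memv_line.
    - by rewrite memvN memv_line.
  by rewrite leqNgt; move: rank2; rewrite /rs_rank => ->.
exists h; split=> //.
  by apply/andP; split; apply/eqP => hE; apply: ha; [left | right].
by case: ga gh => -> //; rewrite dotNl oppr_eq0.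
Qed.

(** For b = a or -a choose g independent of a and not orthogonal to it. The reflected root b' has
    nonzero g-coefficient, hence is independent of a, and x_b(t) is a w_g-conjugate of an element at
    b'; both w_g and that element commute with the class. *)
Lemma yX_central a b t : a \in rt -> b \in rt -> commute (yX a r s) (X b t).
Proof.
move=> aP bP; have [|] := boolP (nonprop a b); first exact: yX_commute_nonprop.
rewrite negb_and !negbK => /orP ba; have [g [gP ag a_g]] := exists_nonorth aP.
have gNP : - g \in rt by rewrite root_opp.
have agN : nonprop a (- g).
  by move: ag; rewrite /nonprop eqr_opp eqr_oppLR andbC.
have cW : commute (yX a r s) (weylX g).
  by do !apply: commuteM; apply: yX_commute_nonprop.
have b_g : dot b g != 0.
  by case: ba => /eqP->; rewrite ?dotNl ?oppr_eq0.
have [z zE] := cartan_int gP bP.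
have z0 : z != 0.
  apply: contraNneq b_g => z0; move: zE; rewrite z0 mul0r => /eqP.
  by rewrite mulf_eq0 pnatr_eq0.
have b'P := root_refl gP bP zE; set b' := b - g *~ z in b'P.
have b'E : 2 * dot b' g = (- z)%:~R * dot g g.
  by rewrite dotDl dotNl dotMzl mulrBr zE intrN; ring.
have [k kE hW] := X_weyl gP b'P b'E.
have ab' : nonprop a b'.
  have [k1 k1E] : exists k1 : int, b = a *~ k1 + g *~ 0.
    by case: ba => /eqP->; [exists 1 | exists (-1)]; rewrite mulr0z addr0 ?mulrNz mulr1z.
  have b'c : b' = a *~ k1 + g *~ (- z) by rewrite /b' {1}k1E mulr0z addr0 mulrNz.
  rewrite b'c {1}(intcomb10 a g); apply: (lincomb_nonprop redPhi aP gP ag).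
    by rewrite xpair_eqE; move: z0; clear; lia.
  by rewrite xpair_eqE opprK; move: z0; clear; lia.
have [/= + _] := hW (k%:~R * t); rewrite mulrNz opprK /b' subrK.
have -> : k%:~R * (k%:~R * t) = t.
  by case: kE => ->; rewrite ?mulrN1z ?mulr1z ?mulN1r ?mul1r ?opprK.
move=> h; have -> : X b t = (weylX g * X b' (k%:~R * t) * (weylX g)^-1)%g by rewrite h mulgK.
apply: commuteM; last exact: commuteV.
by apply: commuteM => //; apply: yX_commute_nonprop.
Qed.

Lemma yX_centralT a b t : a \in rt -> commute (yX a r s) (X b t).
Proof.
move=> aP; have [bP|bP] := boolP (b \in rt); first exact: yX_central.
by rewrite X_out //; apply: commute1.
Qed.

Lemma yXNr a : a \in rt -> yX a r (- s) = ((yX a r s)^-1)%g.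
Proof.
by move=> aP; rewrite /yX XN commutatorVr //; apply/commute_sym/yX_centralT.
Qed.

Lemma yX_opp a : a \in rt -> yX a (- r) (- s) = yX a r s.
Proof.
move=> aP; rewrite /yX !XN commutatorVV //; apply/commute_sym/yX_central => //.
by rewrite root_opp.
Qed.

(** Centrality makes conjugation by w_g trivial on the class of y_d(r, s), while [X_weyl] computes
    the conjugate as y at the reflected root with both arguments multiplied by k; [yX_opp] removes
    the sign. *)
Lemma yX_refl g d (z : int) : g \in rt -> d \in rt -> 2 * dot d g = z%:~R * dot g g ->
  yX (d - g *~ z) r s = yX d r s.
Proof.
move=> gP dP zE; have [k kE hW] := X_weyl gP dP zE.
have gNP : - g \in rt by rewrite root_opp.
have d'P := root_refl gP dP zE; set d' := d - g *~ z in d'P hW *.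
have cW : commute (yX d r s) (weylX g).
  by do !apply: commuteM; apply: yX_central.
have [/= h1 _] := hW r; have [/= _ h2] := hW s.
have : (weylX g * yX d r s * (weylX g)^-1)%g = yX d r s by rewrite -cW mulgK.
rewrite /yX commutator_conj h1 h2 !mulgK => <-.
case: kE => ->; first by rewrite mulr1z !mul1r.
by rewrite mulrN1z !mulN1r -/(yX d' (- r) (- s)) yX_opp.
Qed.

Lemma yX_equal_length a b : a \in rt -> b \in rt -> dot a a = dot b b ->
  yX a r s = yX b r s.
Proof.
move=> aP bP ab; symmetry.
apply: (orbit_equal_length redPhi irrPhi (S := fun c => yX c r s = yX a r s) _ aP bP ab) => //.
by move=> g c z gP cP zE <-; apply: yX_refl.
Qed.

Lemma yXMn a n : a \in rt -> yX a r (n%:R * s) = (yX a r s ^+ n)%g.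
Proof.
move=> aP; rewrite /yX XMn commutator_expr //; apply/commute_sym/yX_central => //.
by rewrite root_opp.
Qed.

End Central.

Lemma yX_sum r s d g (q : nat) : A r -> B s -> d \in rt -> g \in rt -> nonprop d g ->
  q = 2%N \/ q = 3%N -> gram dot d g q%:Z (-1) -> yX (d + g) r s = (yX d r s ^+ q)%g.
Proof.
move=> Ar Bs dP gP dg q23 gr.
have q23' : q%:Z = 2 \/ q%:Z = 3 by case: q23 => ->; [left | right].
have AM k : A (k * r) by case: idA => _ _; apply.
have BM k : B (k * s) by case: idB => _ _; apply.
have zP := sum_root dP gP gr; set z := d + g in zP.
have NzP : - z \in rt by rewrite root_opp.
have [k1 k1E hk1] := sum_sign e redPhi dP gP dg q23' gr.
have [c [w1 [w2 [hc hw W]]]] := X_comm dP gP dg.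
have gz : nonprop g (- z).
  have := lincomb_nonprop redPhi dP gP dg (i := 0) (j := 1) (k := -1) (l := -1) isT isT.
  by rewrite mulr1z mulr0z add0r !mulrNz !mulr1z -opprD.
have [c' [w1' [w2' [hc' hw' W']]]] := X_comm gP NzP gz.
have ck : c = k1.
  have eP := chevalley_faithful e zP; apply/eqP; rewrite -subr_eq0; apply/eqP.
  by apply: (mulrz_mx_eq0 eP); rewrite mulrzBr -hc -hk1 subrr.
have c'E : c' = c * q%:Z by apply: (sum_constants redPhi dP gP dg q23' gr hc hc').
(* As c^2 = 1, the letter at z in [x_d(a), x_g(1)] is exactly x_z(r). *)
pose a := c%:~R * r.
have cc (R' : pzRingType) : c%:~R * c%:~R = 1 :> R'.
  by rewrite -intrM ck; case: k1E => ->.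
have Aa : A a by apply: AM.
have Bt : B (c'%:~R * (- 1) * s) by apply: BM.
set x := X d a; set u := X g 1; set v := X (- z) s.
have gzE : g - z = - d by rewrite /z opprD addrCA subrr addr0.
pose P := commutator x u.
have PE : P = (wordX a 1 w1 * X z r * wordX a 1 w2)%g.
  by rewrite /P W -/z mulr1 /a mulrA cc mul1r.
(* Conjugating [P = [x_d, x_g]] by [x_{-z}] is computed on both expressions of [P]. *)
have yP y : (forall b t, commute y (X b t)) -> commute y P.
  move=> yX; rewrite PE; apply: commuteM; first apply: commuteM => //.
    by apply: commute_wordX => *; apply: yX.
  by apply: commute_wordX => *; apply: yX.
(* The sum i d + j g - z vanishes only for i = j = 1, so v commutes with every letter of P except
   x_z(r), and passing that one costs the inverse of y_z(r, s). *)
have conj1 : (v * P * v^-1)%g = ((yX z r s)^-1 * P)%g.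
  have vw w : all (higher_letter d g) w -> commute v (wordX a 1 w).
    move=> hall; apply: commute_wordX => k kw.
    have /higher_letterP[i [j [-> -> -> [i0 j0] ij]]] := allP hall k kw.
    apply/commute_sym; apply: X_commute => //.
    - rewrite intcomb_nat (_ : - z = d *~ (-1) + g *~ (-1)); last first.
        by rewrite !mulrNz !mulr1z -opprD.
      rewrite lincombD; apply: (intcomb_neq0 redPhi) => //.
      by move: ij; rewrite !xpair_eqE; clear; lia.
    - exact: ideal_scale.
  have /andP[hw1 hw2] : all (higher_letter d g) w1 && all (higher_letter d g) w2.
    by rewrite -all_cat.
  have vX : (v * X z r)%g = ((yX z r s)^-1 * X z r * v)%g.
    by rewrite /yX -commutatorV /commutator !mulgVK.
  have yw : commute (wordX a 1 w1) (yX z r s)^-1%g.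
    by apply/commuteV/commute_sym/commute_wordX => *; apply: yX_centralT.
  rewrite PE !mulgA (vw _ hw1) -(mulgA _ v) vX -!mulgA (mulgA v) (vw _ hw2) -!mulgA mulgV mulg1.
  by rewrite !mulgA yw.
(* Here v commutes with x_d(a) because d - z = -g, so only x_g(1) changes, by the factor
   [x_g(-1), v]. Since d + i g - j z vanishes only for i = j = 1, the sole letter of that factor not
   commuting with x_d(a) is the one at g - z = -d. *)
have conj2 : (v * P * v^-1)%g = (P * yX d a (c'%:~R * (- 1) * s))%g.
  have vx : commute x v.
    apply: X_commute => //.
    by rewrite /z opprD addrA subrr sub0r oppr_eq0 (root_neq0 gP).
  rewrite /P commutator_conj -vx mulgK conj_commutator /u -XN W' gzE.
  have xw w : all (higher_letter g (- z)) w -> commute x (wordX (- 1) s w).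
    move=> hall; apply: commute_wordX => k kw.
    have /higher_letterP[i [j [-> -> -> [i0 j0] ij]]] := allP hall k kw.
    apply: X_commute => //.
    - rewrite (_ : d + _ = d *~ (1 - j%:Z) + g *~ (i%:Z - j%:Z)).
        by apply: (intcomb_neq0 redPhi) => //; move: ij; rewrite !xpair_eqE; clear; lia.
      by rewrite /z !mulrzBr mulr1z mulNrn mulrnDl opprD addrA addrACA.
    - by rewrite mulrAC; apply: ideal_scale.
  have /andP[hw1 hw2] : all (higher_letter g (- z)) w1' && all (higher_letter g (- z)) w2'.
    by rewrite -all_cat.
  rewrite commutator_mulr; congr (_ * _)%g.
  have cY : commutator x (wordX (- 1) s w1' * X (- d) (c'%:~R * (- 1) * s) * wordX (- 1) s w2')%g =
      yX d a (c'%:~R * (- 1) * s).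
    rewrite commutator_mul_commuter ?commutator_mul_commutel; [|exact: xw..].
    rewrite -/(yX d a _); have -> := commute_sym (_ : commute (yX d a (c'%:~R * (- 1) * s)) _).
      by rewrite mulgK.
    by apply: commute_wordX => *; apply: yX_centralT.
  rewrite cY; have -> := commute_sym (_ : commute (yX d a (c'%:~R * (- 1) * s)) _).
    by rewrite mulgK.
  by apply: yX_centralT.
have : ((yX z r s)^-1)%g = yX d a (c'%:~R * (- 1) * s).
  apply: (mulIg P); rewrite -conj1 conj2.
  by rewrite -yP // => b t; apply: yX_centralT.
have Bq : B (- (q%:R * s)) by rewrite -mulNr.
(* The sign c occurs in both arguments, c r and -c q s, and cancels by [yX_opp]. *)
have -> : yX d a (c'%:~R * (- 1) * s) = yX d r (- (q%:R * s)).
  have qE : q%:Z%:~R = q%:R :> R by [].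
  rewrite c'E /a ck intrM qE; case: k1E => ->.
    have -> : 1%:~R * q%:R * (- 1) * s = - (q%:R * s) by ring.
    by rewrite mulr1z mul1r.
  have -> : (-1)%:~R * q%:R * (- 1) * s = - - (q%:R * s) by ring.
  by rewrite mulrN1z mulN1r yX_opp.
rewrite yXNr // => /invg_inj ->.
exact: yXMn.
Qed.

End ElementaryCommutators.

(** * The ratio of root lengths *)

Section StandardNorms.
Context (F : realFieldType).

Lemma rowdotE n (u v : 'rV[F]_n) : rowdot u v = \sum_j u 0 j * v 0 j.
Proof. by rewrite /rowdot mxE; apply: eq_bigr => j _; rewrite mxE. Qed.

Lemma rowdotC n (u v : 'rV[F]_n) : rowdot u v = rowdot v u.
Proof. by rewrite !rowdotE; apply: eq_bigr => j _; rewrite mulrC. Qed.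

Lemma rowdotDl n (u v w : 'rV[F]_n) : rowdot (u + v) w = rowdot u w + rowdot v w.
Proof. by rewrite /rowdot mulmxDl mxE. Qed.
Lemma rowdotDr n (u v w : 'rV[F]_n) : rowdot w (u + v) = rowdot w u + rowdot w v.
Proof. by rewrite /rowdot linearD mulmxDr mxE. Qed.
Lemma rowdotZl n k (u v : 'rV[F]_n) : rowdot (k *: u) v = k * rowdot u v.
Proof. by rewrite /rowdot -scalemxAl mxE. Qed.
Lemma rowdotZr n k (u v : 'rV[F]_n) : rowdot u (k *: v) = k * rowdot u v.
Proof. by rewrite /rowdot linearZ -scalemxAr mxE. Qed.
Lemma rowdot_e n (i j : 'I_n) : rowdot ('e_i : 'rV[F]_n) 'e_j = (i == j)%:R.
Proof.
rewrite rowdotE (bigD1 i) //= big1 ?addr0 => [|k ki]; rewrite !mxE !eqxx /= ?mul1r //.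
by rewrite (negPf ki) mul0r.
Qed.

Lemma signr_sqr (s : bool) : (-1) ^+ s * (-1) ^+ s = 1 :> F.
Proof. by rewrite -signr_addb addbb. Qed.

Lemma stdB_norm l (v : 'rV[F]_l) : stdB v -> rowdot v v = 1 \/ rowdot v v = 2.
Proof.
case=> [[i [s ->]]|[i [j [s [t [ij ->]]]]]]; [left|right].
  by rewrite rowdotZl rowdotZr mulrA signr_sqr rowdot_e eqxx mul1r.
rewrite !rowdotDl !rowdotDr !rowdotZl !rowdotZr !rowdot_e !mulrA !signr_sqr !eqxx.
by rewrite (eq_sym j i) (negPf ij) /=; ring.
Qed.

Lemma stdC_norm l (v : 'rV[F]_l) : stdC v -> rowdot v v = 4 \/ rowdot v v = 2.
Proof.
case=> [[i [s ->]]|[i [j [s [t [ij ->]]]]]]; [left|right].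
  rewrite rowdotZl rowdotZr mulrA signr_sqr rowdotZl rowdotZr rowdot_e eqxx /=; ring.
rewrite !rowdotDl !rowdotDr !rowdotZl !rowdotZr !rowdot_e !mulrA !signr_sqr !eqxx.
by rewrite (eq_sym j i) (negPf ij) /=; ring.
Qed.

Lemma stdF4_norm (v : 'rV[F]_4) : stdF4 v -> rowdot v v = 1 \/ rowdot v v = 2.
Proof.
case=> [/stdB_norm//|[s ->]]; left; rewrite rowdotE.
under eq_bigr => j _ do rewrite !mxE mulrACA signr_sqr.
by rewrite sumr_const card_ord; field.
Qed.

Lemma stdG2_norm (v : 'rV[F]_3) : stdG2 v -> rowdot v v = 2 \/ rowdot v v = 6.
Proof.
case=> [[i [j [ij ->]]]|[i [j [k [s [ij jk ik ->]]]]]]; [left|right].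
  rewrite -scaleN1r !rowdotDl !rowdotDr !rowdotZl !rowdotZr !rowdot_e !eqxx.
  by rewrite (eq_sym j i) (negPf ij) /=; ring.
rewrite rowdotZl rowdotZr mulrA signr_sqr -!scaleN1r !rowdotDl !rowdotDr !rowdotZl !rowdotZr.
rewrite !rowdot_e !eqxx (negPf ij) (negPf jk) (negPf ik).
by rewrite (eq_sym j i) (eq_sym k i) (eq_sym k j) (negPf ij) (negPf jk) (negPf ik) /=; ring.
Qed.

End StandardNorms.

(** * A pair of roots realising the ratio of squared lengths *)

Section LengthRatio.
Context (F : realFieldType) (V : vectType F) (dot : {dot V for idfun}).
Context (Phi : root_system dot).
Hypotheses (redPhi : reduced Phi) (irrPhi : irreducible Phi).
Local Notation rt := (rs_roots Phi).
Implicit Types a b c d g : V.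

Lemma short_long_pair a b : a \in rt -> b \in rt -> dot a a < dot b b ->
  exists g (q : nat), [/\ g \in rt, dot g g = dot a a, nonprop b g, q = 2%N \/ q = 3%N &
    gram dot b g q%:Z (-1)].
Proof.
move=> aP bP ab.
have [g [gP ga _ gb]] := @orbit_nonorth _ _ _ _ irrPhi (fun=> True) a b
  (fun _ _ _ _ _ _ _ => I) aP bP I.
have gE : dot g g < dot b b by rewrite ga.
have neq c : dot c c < dot b b -> nonprop b c.
  move=> cb; apply/andP; split; apply: contraTneq cb => ->; first by rewrite ltxx.
  by rewrite dotNl dotNr opprK ltxx.
have [g' [g'P g'E g'b]] : exists g', [/\ g' \in rt, dot g' g' = dot g g & dot b g' < 0].
  have [gb0|gb0] := ltrP (dot b g) 0; first by exists g.
  exists (- g); rewrite root_opp dotNl !dotNr opprK; split=> //.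
  by rewrite oppr_lt0 lt_def gb0 dotC gb.
have np : nonprop b g' by apply: neq; rewrite g'E.
have [n nE] := cartan_int g'P bP; have [k kE] := cartan_int bP g'P.
have [h1 h2 h3] := cartan_prod redPhi g'P bP (nonprop_sym np) nE kE.
have g0 := dot_root_gt0 g'P; have b0 := dot_root_gt0 bP.
have n0 : n < 0.
  by rewrite -(ltr_int F) -(pmulr_llt0 _ g0) -nE; lra.
have k0 : k < 0.
  by rewrite -(ltr_int F) -(pmulr_llt0 _ b0) -kE dotC; lra.
have kn : n < k.
  rewrite -(ltr_int F); have : n%:~R * dot g' g' = k%:~R * dot b b.
    by rewrite -nE -kE dotC.
  rewrite -(ltr_int F) in k0; rewrite -g'E in gE; nra.
have k1 : k = -1 by move: h1 n0 k0 kn; clear; nia.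
have [q qE] : exists q : nat, n = - q%:Z by exists (absz n); move: n0; clear; lia.
exists g', q; split=> //; first by rewrite g'E.
  by move: h1 kn; rewrite k1 qE; clear; lia.
split; last by rewrite nE qE intrM !intrN mulrN1.
have := kE; rewrite k1 dotC nE qE intrN mulrN1z !mulNr mul1r => /oppr_inj ->//.
Qed.

(** An isomorphism preserves Cartan integers but not lengths; the quotient of the two Cartan
    integers of a non-orthogonal pair is the ratio of squared lengths. *)
Lemma root_isom_ratio n (Psi : set 'rV[F]_n) b g (q : int) : root_isom Phi Psi ->
  b \in rt -> g \in rt -> gram dot b g q (-1) -> q != 0 ->
  exists u v : 'rV[F]_n, [/\ Psi u, Psi v & rowdot u u = q%:~R * rowdot v v].
Proof.
case=> f [_ fPsi fE] bP gP [g1 g2] q0.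
have inPsi a : a \in rt -> Psi (f a) by rewrite -fPsi => aP; exists a.
exists (f b), (f g); split; [exact: inPsi..|].
have g0 := dot_root_gt0 gP; have b0 := dot_root_gt0 bP.
have qF : q%:~R != 0 :> F by rewrite intr_eq0.
have c1 := fE _ _ gP bP; have c2 := fE _ _ bP gP.
have e1 : cartan dot b g = - q%:~R.
  by rewrite /cartan g2 mulfK ?gt_eqF // intrM mulrN1z mulrN1.
have e2 : cartan dot g b = -1.
  rewrite /cartan (dotC dot g b) g2 g1 intrM mulrN1z; field.
  by rewrite qF (lt0r_neq0 g0).
move: c1 c2; rewrite e1 e2 /cartan (rowdotC (f g)).
(* Division by 0 yields 0, whereas the Cartan integer is nonzero, so the image has nonzero norm. *)
have [->|v0] := eqVneq (rowdot (f g) (f g)) 0.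
  by rewrite invr0 mulr0 => /esym/eqP; rewrite oppr_eq0 (negPf qF).
have [->|u0] := eqVneq (rowdot (f b) (f b)) 0.
  by rewrite invr0 mulr0 => _ /esym/eqP; rewrite oppr_eq0 oner_eq0.
move=> /(canRL (divfK v0)) h1 /(canRL (divfK u0)) h2.
by apply: oppr_inj; rewrite -mulN1r -h2 h1 mulNr.
Qed.

End LengthRatio.

(** * Generated subgroups and normal closures *)

Section GeneratedSubgroups.
Context (G : groupType).
Local Open Scope group_scope.

Lemma gen_subgroupP (S : set G) : is_subgroup (gen_subgroup S).
Proof.
split=> [H [[]] //|g h Sg Sh H HP|g Sg H HP].
  by have [[_ HM _] _] := HP; apply: HM; [apply: Sg | apply: Sh].
by have [[_ _ HV] _] := HP; apply: HV; apply: Sg.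
Qed.

Lemma gen_subgroup_sub (S : set G) g : S g -> gen_subgroup S g.
Proof. by move=> Sg H [_]; apply. Qed.

Lemma normal_closureP (E S : set G) : is_subgroup (normal_closure E S).
Proof.
split=> [H [[[]]] //|g h Sg Sh H HP|g Sg H HP].
  by have [[[_ HM _] _] _] := HP; apply: HM; [apply: Sg | apply: Sh].
by have [[[_ _ HV] _] _] := HP; apply: HV; apply: Sg.
Qed.

Lemma normal_closure_conj (E S : set G) g h : E g -> normal_closure E S h ->
  normal_closure E S (g * h * g^-1).
Proof.
by move=> Eg Nh H HP; have [[_ HJ] _] := HP; apply: HJ => //; apply: Nh.
Qed.

Lemma normal_closure_sub (E S : set G) g : S g -> normal_closure E S g.
Proof. by move=> Sg H [_]; apply. Qed.

End GeneratedSubgroups.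

(** * From the abstract quotient to congruences modulo E(Phi, R, AB) *)

Section Main.
Context (F : realFieldType) (V : vectType F) (dot : {dot V for idfun}).
Context (Phi : root_system dot) (m : nat) (e : chevalley_rep Phi m.+1).
Hypotheses (redPhi : reduced Phi) (irrPhi : irreducible Phi) (rank2 : (2 <= rs_rank Phi)%N).
Local Notation rt := (rs_roots Phi).
Context (R : comNzRingType) (A B : set R) (idA : is_ideal A) (idB : is_ideal B).
Local Notation E := (elementary e [set: R]%classic).
Local Notation N := (relative_elementary e (product_ideal A B)).

Lemma xroot_out a (r : R) : a \notin rt -> xroot e a r = 1%g.
Proof. by move=> aP; apply: Defs.GLval_inj; rewrite Defs.GLval1 /GLval /= expmx_out. Qed.

Lemma elementaryP : is_subgroup E.
Proof. exact: gen_subgroupP. Qed.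

Lemma relative_elementaryP : is_subgroup N.
Proof. exact: normal_closureP. Qed.

Lemma elementary_xroot a (r : R) : E (xroot e a r).
Proof.
have [aP|aP] := boolP (a \in rt); first by apply: gen_subgroup_sub; exists a, r.
by rewrite xroot_out //; have [] := elementaryP.
Qed.

(** The exponent comes with a pair of roots realising it as a ratio of squared lengths, so its value
    can be read off from the type of Phi afterwards. *)
Lemma ycomm_relations (r s : R) : A r -> B s ->
  (forall a b, a \in rt -> b \in rt -> dot a a = dot b b ->
     eqmod N (ycomm e a r s) (ycomm e b r s)) /\
  (forall a b, a \in rt -> b \in rt -> dot a a < dot b b ->
     exists g (q : nat), [/\ g \in rt, q = 2%N \/ q = 3%N, gram dot b g q%:Z (-1) &
       eqmod N (ycomm e a r s) (ycomm e b r s ^+ q)%g]).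
Proof.
move=> Ar Bs.
have subE := elementaryP.
have subN := relative_elementaryP.
have [E1 EM EV] := subE.
have [Q [p [pM pE]]] := quotient_group subE subN (@normal_closure_conj _ _ _).
have Ex a t : E (xroot e a t) by apply: elementary_xroot.
have p1 : p 1%g = 1%g by apply: (mulgI (p 1%g)); rewrite -pM // !mulg1.
have pV g : E g -> p (g^-1)%g = (p g)^-1%g.
  by move=> Eg; apply: (mulgI (p g)); rewrite -pM ?mulgV //; apply: EV.
have EX g k : E g -> E (g ^+ k)%g.
  by move=> Eg; elim: k => [|k IHk]; rewrite ?expg0 // expgS; apply: EM.
have pX g k : E g -> p (g ^+ k)%g = (p g ^+ k)%g.
  by move=> Eg; elim: k => [|k IHk]; rewrite ?expg0 // !expgS pM ?IHk //; apply: EX.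
have Ecomm g h : E g -> E h -> E (commutator g h).
  by move=> Eg Eh; apply: EM (EM _ _ (EM _ _ Eg Eh) (EV _ Eg)) (EV _ Eh).
have pcomm g h : E g -> E h -> p (commutator g h) = commutator (p g) (p h).
  move=> Eg Eh; have Egh := EM _ _ Eg Eh; have Eghg := EM _ _ Egh (EV _ Eg).
  by rewrite /commutator (pM _ _ Eghg (EV _ Eh)) (pM _ _ Egh (EV _ Eg)) (pM _ _ Eg Eh) !pV.
pose X a t := p (xroot e a t).
have Ew t u w : E (gword e t u w) /\ p (gword e t u w) = wordX X t u w.
  elim: w => [|k w [IH1 IH2]]; first by rewrite gword_nil /wordX big_nil.
  by rewrite gword_cons /wordX big_cons pM // IH2; split=> //; apply: EM.
have XD a t u : X a (t + u) = (X a t * X a u)%g by rewrite /X xrootD pM.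
have X_out a t : a \notin rt -> X a t = 1%g by move=> aP; rewrite /X xroot_out.
have X_AB a t : product_ideal A B t -> X a t = 1%g.
  move=> tAB; have [aP|aP] := boolP (a \in rt); last exact: X_out.
  rewrite /X -p1; apply/pE => //; rewrite mulg1.
  have [_ _ NV] := subN; apply: NV.
  by apply: normal_closure_sub; apply: gen_subgroup_sub; exists a, t.
have X_comm a b : a \in rt -> b \in rt -> nonprop a b ->
     exists (c : int) (w1 w2 : seq (V * (int * nat * nat))),
     [/\ lie (e a) (e b) = e (a + b) *~ c, all (higher_letter a b) (w1 ++ w2) &
       forall t u, commutator (X a t) (X b u) =
         (wordX X t u w1 * X (a + b) (c%:~R * t * u)%R * wordX X t u w2)%g].
  move=> aP bP ab; have [c [w1 [w2 [hc hw W]]]] := chevalley_commutator redPhi e aP bP ab.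
  exists c, w1, w2; split=> // t u; rewrite -pcomm // W.
  have [Ew1 pw1] := Ew t u w1; have [Ew2 pw2] := Ew t u w2.
  have E2 := EM _ _ Ew1 (Ex (a + b) (c%:~R * t * u)).
  by rewrite (pM _ _ E2 Ew2) (pM _ _ Ew1 (Ex _ _)) pw1 pw2.
have X_weyl g d (z : int) : g \in rt -> d \in rt -> 2 * dot d g = z%:~R * dot g g ->
     exists2 k : int, k = 1 \/ k = -1 & let d' := d - g *~ z in
     forall t, (weylX X g * X d t = X d' (k%:~R * t)%R * weylX X g)%g /\
               (weylX X g * X (- d)%R t = X (- d')%R (k%:~R * t)%R * weylX X g)%g.
  move=> gP dP zE; have [k kE /= [h1 h2]] := weyl_rootvec_opp redPhi e gP dP zE.
  have E2 := EM _ _ (Ex g 1) (Ex (- g) (- 1)); have EW := EM _ _ E2 (Ex g 1).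
  have pW : p (weylg e R g) = weylX X g by rewrite /weylg (pM _ _ E2) // pM.
  exists k => //= t; rewrite -pW /X -!pM //.
  by rewrite (weyl_xroot kE h1) (weyl_xroot kE h2).
have Ey a : E (ycomm e a r s) by apply: Ecomm.
have py a : p (ycomm e a r s) = yX X a r s by rewrite /ycomm pcomm.
split=> [a b aP bP ab|a b aP bP ab].
  by apply/pE => //; rewrite !py; apply: (yX_equal_length redPhi irrPhi rank2 idA idB XD X_out X_AB X_comm X_weyl).
have [g [q [gP ga bg q23 gr]]] := short_long_pair redPhi irrPhi aP bP ab.
exists g, q; split=> //; apply/pE => //; first exact: EX.
rewrite pX // !py.
(* The root b + g has the length of g, which is that of a, so the relation for equal lengths
   finishes the proof. *)
rewrite -(yX_sum redPhi irrPhi rank2 idA idB XD X_out X_AB X_comm X_weyl Ar Bs bP gP bg q23 gr) //.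
apply: (yX_equal_length redPhi irrPhi rank2 idA idB XD X_out X_AB X_comm X_weyl) => //.
  exact: (sum_root bP gP gr).
by rewrite (sum_dot gr).
Qed.


(** Squared lengths in the standard models are 1 and 2 for B_l and F_4, 2 and 4 for C_l, 2 and 6 for
    G_2. This excludes the ratio 3 in the first three types and the ratio 2 in G_2. *)
Lemma ratio_of_type b g (p q : nat) : b \in rt -> g \in rt -> q = 2%N \/ q = 3%N ->
  gram dot b g q%:Z (-1) ->
  ((exists2 l : nat, (2 <= l)%N & typeB Phi l \/ typeC Phi l) \/ typeF4 Phi) /\ p = 2%N \/
  typeG2 Phi /\ p = 3%N -> q = p.
Proof.
move=> bP gP q23 gr; have q0 : q%:Z != 0 by case: q23 => ->.
have key l (Psi : set 'rV[F]_l) := fun T => root_isom_ratio (Psi := Psi) T bP gP gr q0.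
have q2F : (2%N : int)%:~R = 2 :> F by [].
have q3F : (3%N : int)%:~R = 3 :> F by [].
case=> -[T ->]; case: q23 key => -> // key.
- case: T => [[l _ [] T]|T]; have [u [v [hu hv]]] := key _ _ T; rewrite q3F => h;
    exfalso; move: h.
  + by have [->|->] := stdB_norm hu; have [->|->] := stdB_norm hv; lra.
  + by have [->|->] := stdC_norm hu; have [->|->] := stdC_norm hv; lra.
  + by have [->|->] := stdF4_norm hu; have [->|->] := stdF4_norm hv; lra.
- have [u [v [hu hv]]] := key _ _ T; rewrite q2F => h.
  exfalso; move: h.
  by have [->|->] := stdG2_norm hu; have [->|->] := stdG2_norm hv; lra.
Qed.

End Main.

Lemma eqmod_trivial (R : comPzRingType) n (N : set (GL R n)) (g h : GL R n) :
  is_subgroup N -> (forall X Y : 'M[R]_n, X = Y) -> eqmod N g h.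
Proof.
by case=> N1 _ _ triv; rewrite /eqmod (_ : (_ * _)%g = 1%g) //; apply: Defs.GLval_inj.
Qed.

(** The evaluation of Z[s, t] in R behind the commutator formula is stated for rings whose type
    includes 1 != 0; this repackages R without changing its operations. *)
Lemma nonzero_comNzRing (R : comPzRingType) : (1 : R) != 0 ->
  exists S : comNzRingType, (S : comPzRingType) = R.
Proof.
case: R => T c R1; pose R := GRing.ComPzRing.Pack c.
pose S : comNzRingType := HB.pack (GRing.ComPzRing.sort R)
  (GRing.PzSemiRing_isNonZero.Build (GRing.ComPzRing.sort R) R1).
by exists S.
Qed.

Theorem theorem4 (F : realFieldType) (V : vectType F) (dot : {dot V for idfun})
    (Phi : root_system dot) (n : nat) (e : chevalley_rep Phi n)
    (R : comPzRingType) (A B : set R) :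
  reduced Phi -> irreducible Phi -> (2 <= rs_rank Phi)%N ->
  is_ideal A -> is_ideal B ->
  (typeC Phi 2 \/ typeG2 Phi -> no_residue_field_card2 R) ->
  (forall l : nat, (2 <= l)%N -> typeC Phi l ->
     forall c : R, exists r s : R, c = c ^+ 2 * r + 2 * c * s) ->
  forall a b : R, A a -> B b ->
  (forall alpha beta : V, alpha \in rs_roots Phi -> beta \in rs_roots Phi ->
     dot alpha alpha = dot beta beta ->
     eqmod (relative_elementary e (product_ideal A B))
       (ycomm e alpha a b) (ycomm e beta a b)) /\
  (forall p : nat,
     ((exists2 l : nat, (2 <= l)%N & typeB Phi l \/ typeC Phi l) \/ typeF4 Phi)
       /\ p = 2%N \/ typeG2 Phi /\ p = 3%N ->
   forall alpha beta : V, short_root Phi alpha -> long_root Phi beta ->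
     eqmod (relative_elementary e (product_ideal A B))
       (ycomm e alpha a b) ((ycomm e beta a b) ^+ p)%g).
Proof.
move=> redPhi irrPhi rank2 idA idB _ _ a b Aa Bb.
suff [H1 H2] : (forall alpha beta, alpha \in rs_roots Phi -> beta \in rs_roots Phi ->
     dot alpha alpha = dot beta beta ->
     eqmod (relative_elementary e (product_ideal A B)) (ycomm e alpha a b) (ycomm e beta a b)) /\
  (forall alpha beta, alpha \in rs_roots Phi -> beta \in rs_roots Phi ->
     dot alpha alpha < dot beta beta ->
     exists g (q : nat), [/\ g \in rs_roots Phi, q = 2%N \/ q = 3%N, gram dot beta g q%:Z (-1) &
       eqmod (relative_elementary e (product_ideal A B))
         (ycomm e alpha a b) (ycomm e beta a b ^+ q)%g]).
  split=> // p Tp alpha beta [alphaP short] [betaP long].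
  have lt_ab : dot alpha alpha < dot beta beta.
    rewrite ltNge; apply/negP => ba; apply: short; split=> // c cP.
    exact: le_trans (long c cP) ba.
  have [g [q [gP q23 gr]]] := H2 _ _ alphaP betaP lt_ab.
  by rewrite (ratio_of_type betaP gP q23 gr Tp).
have triv : (forall X Y : 'M[R]_n, X = Y) -> forall g h : GL R n,
    eqmod (relative_elementary e (product_ideal A B)) g h.
  by move=> XY g h; apply: eqmod_trivial => //; apply: normal_closureP.
(* For n = 0 or the zero ring there is only one matrix, so every congruence holds; the remaining
   case has n = m + 1 and 1 != 0. *)
have reduce : ((forall X Y : 'M[R]_n, X = Y) \/ (0 < n)%N /\ (1 : R) != 0).
  have [n0|n0] := posnP n.
    by left=> X Y; apply/matrixP => i; have := ltn_ord i; rewrite {2}n0.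
  have [R0|R0] := eqVneq (1 : R) 0; last by right.
  by left=> X Y; apply/matrixP => i j; rewrite -[X i j]mul1r -[Y i j]mul1r R0 !mul0r.
case: reduce => [/triv h|[n0 R1]].
  split=> // alpha beta aP bP ab.
  have [g [q [gP _ _ q23 gr]]] := short_long_pair redPhi irrPhi aP bP ab.
  by exists g, q.
case: n e n0 {triv} => // m e _.
have [S RS] := nonzero_comNzRing R1; case: R / RS A B idA idB a b Aa Bb {R1} => *.
exact: ycomm_relations.
Qed.
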